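(* Let $(M,g)$ be a Riemannian manifold, and let $(\varphi_A,\xi_A,\eta_A,G_A)$ be the contact metric structure on the unit tangent bundle $T_1(M)$ described in the context, where $a>0$ denotes the constant $a(\frac12)$. Then $(\varphi_A,\xi_A,\eta_A,G_A)$ is K-contact if and only if $(M,g)$ has positive constant sectional curvature $\frac1a$. In this case $T_1(M)$ is a Sasakian manifold.
   Context: Let $a,b:[0,+\infty)\to[0,+\infty)$ be smooth with $a>0$, $\epsilon=\pm1$, $t=\frac12g(\mathtt{u},\mathtt{u})$. $T(M)\setminus0$ carries the metric $g_A(X^H,Y^H)=g(X,Y)$, $g_A(X^H,Y^V)=0$, $g_A(X^V,Y^V)=a(t)g(X,Y)+b(t)g(X,\mathtt{u})g(Y,\mathtt{u})$ ($X^H,X^V$ horizontal and vertical lifts) and a compatible almost complex structure $$J_AX^H=\frac1{\sqrt{a}}X^V-\frac1{2t}\left(\frac1{\sqrt{a}}+\frac{\epsilon}{\sqrt{a+2bt}}\right)g(X,\mathtt{u})\mathtt{u}^V,\quad J_AX^V=-\sqrt{a}X^H+\frac1{2t}\left(\sqrt{a}+\epsilon\sqrt{a+2bt}\right)g(X,\mathtt{u})\mathtt{u}^H,$$ which induce an almost contact metric structure on the hypersurface $T_1M=\{\mathtt{u}:g(\mathtt{u},\mathtt{u})=1\}$ (tangential part of $J_A$ as $\varphi_A$, $\xi_A=-J_AN$ with $N$ the unit normal, $\eta_A(U)N$ the normal part of $J_AU$). In local coordinates $(x^i,y^i)$ of $T(M)$, with $g_{i0}=g_{ij}y^j$, $\delta_i=\frac{\partial}{\partial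 x^i}-\Gamma_{ij}^ky^j\frac{\partial}{\partial y^k}$ and $Y_i=\frac{\partial}{\partial y^i}-g_{i0}y^h\frac{\partial}{\partial y^h}$, the induced structure is $$\varphi_A\delta_i=\tfrac1{\sqrt a}Y_i,\quad \varphi_AY_i=-\sqrt a(\delta_i^h-g_{i0}y^h)\delta_h,\quad \eta_A(\delta_i)=-\epsilon g_{i0},\quad \eta_A(Y_i)=0,\quad \xi_A=-\epsilon y^k\delta_k,$$ $$G_A(\delta_i,\delta_j)=g_{ij},\quad G_A(\delta_i,Y_j)=0,\quad G_A(Y_i,Y_j)=a(g_{ij}-g_{i0}g_{j0}),\qquad a=a(\tfrac12).$$ The contact metric structure of the theorem is the rescaled one: $$\varphi_A^{\rm new}=\varphi_A,\quad \xi_A^{\rm new}=-2\epsilon\sqrt a\,\xi_A,\quad \eta_A^{\rm new}=-\tfrac{\epsilon}{2\sqrt a}\eta_A,\quad G_A^{\rm new}=\tfrac1{4a}G_A,$$ again denoted $(\varphi_A,\xi_A,\eta_A,G_A)$; it satisfies $d\eta_A(U,V)=G_A(U,\varphi_AV)$ with the convention $d\omega(X,Y)=\frac12\left(X\omega(Y)-Y\omega(X)-\omega([X,Y])\right)$. With $\nabla^A$ the Levi-Civita connection of $G_A$, K-contact means $\nabla^A_U\xi_A=-\varphi_AU$ for all vector fields $U$ on $T_1(M)$; Sasakian means $(\nabla^A_U\varphi_A)V=G_A(U,V)\xi_A-\eta_A(V)U$ for all vector fields $U,V$ on $T_1(M)$. *)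

(* Defs.v *)
From HB Require Import structures.
From mathcomp Require Import all_boot all_order all_algebra.
From mathcomp Require Import all_classical all_reals all_analysis.

Set Implicit Arguments.
Unset Strict Implicit.
Unset Printing Implicit Defensive.

Import Order.TTheory GRing.Theory Num.Theory.
Import numFieldNormedType.Exports.

Local Open Scope classical_set_scope.
Local Open Scope ring_scope.

Section Smoothness.
Context {R : realType} {V W : normedModType R}.

Fixpoint iter_derive (f : V -> W) (s : seq V) : V -> W :=
  if s is v :: s' then fun x => 'D_v (iter_derive f s') x else f.

(* C^infinity on an open set A of a finite-dimensional space: every iterated
   directional derivative is (Frechet) differentiable at every point of A. *)
Definition smooth_on (A : set V) (f : V -> W) : Prop :=
  forall (s : seq V) (x : V), A x -> differentiable (iter_derive f s) x.

End Smoothness.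

(* A function on [0, +oo) is smooth iff it is the restriction of a smooth
   function on the line; the values of f at negative numbers are irrelevant. *)
Definition smooth_half_line (R : realType) (f : R -> R) : Prop :=
  exists F : R -> R, smooth_on setT F /\ forall t : R, 0 <= t -> f t = F t.

Record manifold (R : realType) (n : nat) := Manifold {
  points :> topologicalType ;
  points_hausdorff : hausdorff_space points ;
  points_second_countable : @second_countable points ;
  chart : Type ;
  cdom : chart -> set points ;
  cmap : chart -> points -> 'rV[R]_n ;
  cinv : chart -> 'rV[R]_n -> points ;
  cdom_cover : forall p, exists i, cdom i p ;
  cdom_open : forall i, open (cdom i) ;
  cmap_open : forall i, open (cmap i @` cdom i) ;
  cmapK : forall i p, cdom i p -> cinv i (cmap i p) = p ;
  cmap_continuous : forall i p, cdom i p -> {for p, continuous (cmap i)} ;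
  cinv_continuous : forall i x, (cmap i @` cdom i) x ->
    {for x, continuous (cinv i)} ;
  transition_smooth : forall i j,
    smooth_on (cmap i @` (cdom i `&` cdom j)) (cmap j \o cinv i) }.

Section Manifolds.
Context {R : realType} {n : nat}.
Implicit Type M : manifold R n.

Definition ccod M (i : chart M) : set 'rV[R]_n := cmap i @` cdom i.

Definition transition M (i j : chart M) : 'rV[R]_n -> 'rV[R]_n :=
  cmap j \o cinv i.

(* The bilinear form of the Gram matrix field G at x. *)
Definition gform (G : 'rV[R]_n -> 'M[R]_n) (x u v : 'rV[R]_n) : R :=
  (u *m G x *m v^T) 0 0.

End Manifolds.

Record riemannian_metric (R : realType) (n : nat) (M : manifold R n) :=
  RiemannianMetric {
  gram : chart M -> 'rV[R]_n -> 'M[R]_n ;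
  gram_smooth : forall i, smooth_on (ccod i) (gram i) ;
  gram_sym : forall i x, ccod i x -> (gram i x)^T = gram i x ;
  gram_posdef : forall i x u, ccod i x -> u != 0 -> 0 < gform (gram i) x u u ;
  gram_compat : forall i j p u v, cdom i p -> cdom j p ->
    gform (gram i) (cmap i p) u v =
    gform (gram j) (cmap j p) ('D_u (transition i j) (cmap i p))
                              ('D_v (transition i j) (cmap i p)) }.

Section LocalRiemannianGeometry.
Context {R : realType} {n : nat}.
Variable G : 'rV[R]_n -> 'M[R]_n.

Definition christoffel (x : 'rV[R]_n) (k i j : 'I_n) : R :=
  2^-1 * \sum_(l < n) invmx (G x) k l *
    ('D_(delta_mx 0 i) (fun z => G z j l) x +
     'D_(delta_mx 0 j) (fun z => G z i l) x -
     'D_(delta_mx 0 l) (fun z => G z i j) x).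

(* Gamma_ij^k u^i v^j, i.e. the covariant derivative at x of the field with
   constant components v in the direction u. *)
Definition christoffel_form (x u v : 'rV[R]_n) : 'rV[R]_n :=
  \row_k \sum_(i < n) \sum_(j < n) christoffel x k i j * u 0 i * v 0 j.

(* R(X,Y)Z = nabla_X nabla_Y Z - nabla_Y nabla_X Z - nabla_[X,Y] Z, computed on
   the fields with constant components X, Y, Z. *)
Definition riemann (x X Y Z : 'rV[R]_n) : 'rV[R]_n :=
  ('D_X (fun z => christoffel_form z Y Z) x +
     christoffel_form x X (christoffel_form x Y Z)) -
  ('D_Y (fun z => christoffel_form z X Z) x +
     christoffel_form x Y (christoffel_form x X Z)).

Definition sectional (x X Y : 'rV[R]_n) : R :=
  gform G x (riemann x X Y Y) X /
  (gform G x X X * gform G x Y Y - gform G x X Y ^+ 2).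

End LocalRiemannianGeometry.

Definition constant_sectional_curvature (R : realType) (n : nat)
    (M : manifold R n) (g : riemannian_metric M) (c : R) : Prop :=
  forall (i : chart M) (x X Y : 'rV[R]_n),
    ccod i x -> row_free (col_mx X Y) -> sectional (gram g i) x X Y = c.

(* The tangent bundle over a chart with image O and Gram matrix field G. A point
   z = (x, y) of it is the vector y^i d/dx^i at x; a tangent vector v = (p, q)
   at z is p^i d/dx^i + q^i d/dy^i. *)
Notation bundle R n := ('rV[R]_n * 'rV[R]_n)%type.

Section TangentBundle.
Context {R : realType} {n : nat}.
Variables (O : set 'rV[R]_n) (G : 'rV[R]_n -> 'M[R]_n).
Local Notation E := (bundle R n).
Local Notation g z := (gform G z.1).

Definition slit_bundle : set E := [set z | O z.1 /\ z.2 != 0].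

Definition unit_bundle : set E := [set z | O z.1 /\ g z z.2 z.2 = 1].

(* X^i delta_i with delta_i = d/dx^i - Gamma_ij^k y^j d/dy^k. *)
Definition hlift (z : E) (X : 'rV[R]_n) : E :=
  (X, - christoffel_form G z.1 X z.2).

Definition vlift (X : 'rV[R]_n) : E := (0, X).

(* v = hlift z (hpart v) + vlift (vpart z v) *)
Definition hpart (v : E) : 'rV[R]_n := v.1.
Definition vpart (z v : E) : 'rV[R]_n := v.2 + christoffel_form G z.1 v.1 z.2.

Variables (a b : R -> R) (eps : R).

Definition energy (z : E) : R := 2^-1 * g z z.2 z.2.

Definition gA (z v w : E) : R :=
  g z (hpart v) (hpart w) +
  (a (energy z) * g z (vpart z v) (vpart z w) +
   b (energy z) * g z (vpart z v) z.2 * g z (vpart z w) z.2).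

Definition JA (z v : E) : E :=
  let t := energy z in
  let sa := Num.sqrt (a t) in
  let sab := Num.sqrt (a t + 2 * b t * t) in
  let X := hpart v in
  let Y := vpart z v in
  vlift (sa^-1 *: X - ((2 * t)^-1 * (sa^-1 + eps / sab) * g z X z.2) *: z.2) +
  hlift z (- (sa *: Y) +
    ((2 * t)^-1 * (sa + eps * sab) * g z Y z.2) *: z.2).

(* The outward unit normal of the hypersurface g(y, y) = 1. *)
Definition unit_normal (z : E) : E :=
  (Num.sqrt (gA z (vlift z.2) (vlift z.2)))^-1 *: vlift z.2.

(* The induced almost contact metric structure; the same formulas are used off
   the hypersurface, as an extension to the slit tangent bundle. *)
Definition eta_ind (z v : E) : R := gA z (JA z v) (unit_normal z).
Definition phi_ind (z v : E) : E := JA z v - eta_ind z v *: unit_normal z.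
Definition xi_ind (z : E) : E := - JA z (unit_normal z).

Definition phiA (z v : E) : E := phi_ind z v.
Definition xiA (z : E) : E := (- (2 * eps * Num.sqrt (a 2^-1))) *: xi_ind z.
Definition etaA (z v : E) : R := - (eps / (2 * Num.sqrt (a 2^-1))) * eta_ind z v.
Definition GA (z v w : E) : R := (4 * a 2^-1)^-1 * gA z v w.

(* Functions and vector fields on the unit bundle are represented by smooth
   extensions to the slit bundle, which exist because the unit bundle is a
   closed hypersurface in it (extend along rays). Two extensions represent the
   same object iff they agree on the unit bundle; hence all identities below are
   required on the unit bundle only. *)
Definition bundle_function (f : E -> R) : Prop := smooth_on slit_bundle f.

Definition bundle_field (U : E -> E) : Prop :=
  smooth_on slit_bundle U /\
  forall z, unit_bundle z -> 'D_(U z) (fun w : E => g w w.2 w.2) z = 0.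

Definition lie_bracket (U V : E -> E) (z : E) : E :=
  'D_(U z) V z - 'D_(V z) U z.

Record levi_civita (nabla : (E -> E) -> (E -> E) -> E -> E) : Prop :=
  LeviCivita {
  lc_field : forall U V, bundle_field U -> bundle_field V ->
    bundle_field (nabla U V) ;
  lc_addl : forall U V W z,
    bundle_field U -> bundle_field V -> bundle_field W -> unit_bundle z ->
    nabla (fun w => U w + V w) W z = nabla U W z + nabla V W z ;
  lc_addr : forall U V W z,
    bundle_field U -> bundle_field V -> bundle_field W -> unit_bundle z ->
    nabla U (fun w => V w + W w) z = nabla U V z + nabla U W z ;
  lc_scalel : forall f U V z,
    bundle_function f -> bundle_field U -> bundle_field V -> unit_bundle z ->
    nabla (fun w => f w *: U w) V z = f z *: nabla U V z ;
  lc_leibniz : forall f U V z,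
    bundle_function f -> bundle_field U -> bundle_field V -> unit_bundle z ->
    nabla U (fun w => f w *: V w) z =
    f z *: nabla U V z + 'D_(U z) f z *: V z ;
  lc_torsion_free : forall U V z,
    bundle_field U -> bundle_field V -> unit_bundle z ->
    nabla U V z - nabla V U z = lie_bracket U V z ;
  lc_metric : forall U V W z,
    bundle_field U -> bundle_field V -> bundle_field W -> unit_bundle z ->
    'D_(U z) (fun w => GA w (V w) (W w)) z =
    GA z (nabla U V z) (W z) + GA z (V z) (nabla U W z) }.

End TangentBundle.

Section UnitTangentBundle.
Context {R : realType} {n : nat} {M : manifold R n}.
Variables (g : riemannian_metric M) (a b : R -> R) (eps : R).
Local Notation E := (bundle R n).

Definition unit_tangent (i : chart M) : set E :=
  unit_bundle (ccod i) (gram g i).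

Definition bundle_transition (i j : chart M) (z : E) : E :=
  (transition i j z.1, 'D_(z.2) (transition i j) z.1).

(* A vector field on T_1(M): a family of local representatives, one for each
   chart, matching under the differentials of the coordinate changes. *)
Definition vector_field (U : chart M -> E -> E) : Prop :=
  (forall i, bundle_field (ccod i) (gram g i) (U i)) /\
  (forall i j z, unit_tangent i z -> cdom j (cinv i z.1) ->
     U j (bundle_transition i j z) = 'D_(U i z) (bundle_transition i j) z).

(* The connection is given, as a local operator, by its restrictions to the
   parts of T_1(M) over the charts of M. *)
Definition levi_civita_connection
    (nabla : chart M -> (E -> E) -> (E -> E) -> E -> E) : Prop :=
  forall i, levi_civita (ccod i) (gram g i) a b (nabla i).

Variable nabla : chart M -> (E -> E) -> (E -> E) -> E -> E.

Local Notation phi i := (phiA (gram g i) a b eps).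
Local Notation xi i := (xiA (gram g i) a b eps).
Local Notation eta i := (etaA (gram g i) a b eps).
Local Notation GG i := (GA (gram g i) a b).

Definition K_contact : Prop :=
  forall U, vector_field U -> forall i z, unit_tangent i z ->
    nabla i (U i) (xi i) z = - phi i z (U i z).

Definition Sasakian : Prop :=
  forall U V, vector_field U -> vector_field V ->
  forall i z, unit_tangent i z ->
    nabla i (U i) (fun w => phi i w (V i w)) z - phi i z (nabla i (U i) (V i) z)
    = GG i z (U i z) (V i z) *: xi i z - eta i z (V i z) *: U i z.

End UnitTangentBundle.

(* Main.v *)
(* Split a tangent vector of the tangent bundle into its horizontal part X and its
   vertical part P, and let D be the pullback of the Levi-Civita connection of M.
   On the unit bundle the metric is, up to a constant factor, g(X, X') + a g(P, P'),
   the structure equations read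
     [U, V]^h = D_U X_V - D_V X_U,   [U, V]^v = D_U P_V - D_V P_U - R(X_U, X_V)u,
   and D_U u = P_U, so that the Koszul formula becomes
     2 <nabla_U V, W> = 2 g(D_U X_V, X_W) + 2 a g(D_U P_V, P_W)
       - a (g(R(X_U, X_V)u, P_W) - g(R(X_U, X_W)u, P_V) - g(R(X_V, X_W)u, P_U)).
   As xi = 2 sqrt(a) u^H, the equation nabla_U xi = - phi U says exactly that
   a g(R(X, u)u, P) = g(X, P) for all X and all P orthogonal to u, that is, the
   sectional curvature is 1/a; to test it on every P one needs globally defined
   vector fields, built with bump functions. When R has constant curvature 1/a, the
   same formula applied to phi V and to V, paired with W and with phi W, gives the
   Sasakian identity. *)
Require Import Defs.
From HB Require Import structures.
From mathcomp Require Import all_boot all_order all_algebra.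
From mathcomp Require Import all_classical all_reals all_analysis.
From mathcomp Require Import ring lra.

Set Implicit Arguments.
Unset Strict Implicit.
Unset Printing Implicit Defensive.

Import Order.TTheory GRing.Theory Num.Theory.
Import numFieldNormedType.Exports.

Local Open Scope classical_set_scope.
Local Open Scope ring_scope.

(** * Smooth functions *)

(** Fields on the unit bundle are represented on the slit bundle, where |u|, a(t), b(t) and sqrt(a +
    2bt) really vary. Two facts make them harmless. A function constant on the unit bundle has zero
    derivative in tangent directions, because normalising u fixes tangent vectors to first order.
    And a tangent vector has vertical part orthogonal to u, which removes b from the metric and eps
    from phi. The assumption b >= 0 keeps a + 2bt positive, so that its root is smooth and
    invertible.

    The Levi-Civita axioms hold for all fields over a chart, so the test field W may be local, with
    constant components. K-contact speaks only of fields U on all of T_1(M); hence for each P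
    orthogonal to u a global field with value P^V at the given point is needed. Vertical fields
    suffice, because the vector X enters through W. They are also the easy ones to globalise:
    coordinate changes are linear on fibres, so no second derivatives of transition maps occur. The
    Sasakian identity is proved from the constant curvature, not from the K-contact equation
    itself. *)

Section NearEq.
Context {R : realType} {V W : normedModType R}.
Implicit Types f g : V -> W.

(** Split g as f + (g - f): the second summand vanishes near x, so its expansion holds with zero
    differential and zero remainder. *)
Lemma near_eq_differentiable f g x :
  (\near x, f x = g x) -> differentiable f x -> differentiable g x.
Proof.
move=> fg df.
have -> : g = f + (g - f) by apply/funext => y /=; rewrite !fctE addrC subrK.
apply: differentiableD => //.
have h0 : \forall h \near (0 : V), (g - f) (h + x) = 0.
  have : \forall h \near (0 : V), f (h + x) = g (h + x).
    by have := fg; rewrite {1}(near_shift 0 x) subr0.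
  by apply: filterS => h /= fgh; rewrite !fctE fgh subrr.
apply/diff_locallyP.
have E : (g - f) \o shift x = cst ((g - f) x) + (0 : V -> W) +o_ 0 id.
  apply/eqaddoP => e e0; near=> h.
  rewrite !fctE/= addr0.
  have -> : g (h + x) - f (h + x) = 0 by near: h.
  have -> : g x - f x = 0 by rewrite (nbhs_singleton fg) subrr.
  by rewrite subrr normr0 mulr_ge0// ltW.
(* Uniqueness of the differential identifies ['d (g - f) x] with the zero map, which is
   continuous. *)
have @L : {linear V -> W} by exact: (\0).
have := @diff_unique R V W (g - f) L x (@cst_continuous _ _ 0) E.
move=> ->; split; [exact: cst_continuous | exact: E].
Unshelve. all: by end_near. Qed.

End NearEq.

Section Smooth.
Context {R : realType}.
Implicit Types V W Z : normedModType R.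

(* k rounds of differentiability; Ck 0 is no condition at all, so that closure
   properties are proved by induction on k with a trivial base case. *)
Fixpoint Ck V W (k : nat) (A : set V) (f : V -> W) : Prop :=
  if k is k'.+1 then
    (forall x, A x -> differentiable f x) /\ forall v, Ck k' A ('D_v f)
  else True.

Lemma smooth_on_diff V W (A : set V) (f : V -> W) x :
  smooth_on A f -> A x -> differentiable f x.
Proof. by move=> /(_ [::] x)/[apply]. Qed.

Lemma iter_derive_rcons V W (f : V -> W) s v :
  iter_derive f (rcons s v) = iter_derive ('D_v f) s.
Proof. by elim: s => //= u s ->. Qed.

Lemma smooth_on_derive V W (A : set V) (f : V -> W) v :
  smooth_on A f -> smooth_on A ('D_v f).
Proof. by move=> sf s x Ax; rewrite -iter_derive_rcons; exact: sf. Qed.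

(** [iter_derive] puts the head of the sequence outermost while [Ck] differentiates innermost first,
    hence the induction from the end of the sequence. *)
Lemma smooth_on_Ck V W (A : set V) (f : V -> W) :
  smooth_on A f <-> forall k, Ck k A f.
Proof.
split=> [sf k|Cf s].
  elim: k f sf => //= k IH f sf; split; first by move=> x; exact: smooth_on_diff.
  by move=> v; apply: IH; exact: smooth_on_derive.
elim/last_ind: s f Cf => [|s v IH] f Cf x Ax; first by have [+ _] := Cf 1%N; exact.
rewrite iter_derive_rcons; apply: IH => // k.
by have [_] := Cf k.+1; exact.
Qed.

Lemma CkS V W k (A : set V) (f : V -> W) : Ck k.+1 A f -> Ck k A f.
Proof.
elim: k f => // k IH f /= [df Cf]; split=> // v; apply: IH; exact: Cf.
Qed.

Lemma smooth_onS V W (A B : set V) (f : V -> W) :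
  A `<=` B -> smooth_on B f -> smooth_on A f.
Proof. by move=> AB sf s x /AB; exact: sf. Qed.

Lemma near_eq_iter_derive V W (f g : V -> W) s (x : V) :
  (\near x, f x = g x) -> \near x, iter_derive f s x = iter_derive g s x.
Proof.
elim: s => //= v s IH /IH /near_join; apply: filterS => y fgy.
exact: near_eq_derive.
Qed.

(** The formula g may change from point to point; this is what glues a field given by a formula on
    one region to its extension by zero. *)
Lemma smooth_on_locally V W (A : set V) (f : V -> W) :
  (forall x, A x -> exists2 g, \near x, f x = g x & smooth_on [set x] g) ->
  smooth_on A f.
Proof.
move=> H s x Ax; have [g fg sg] := H x Ax.
apply: (@near_eq_differentiable _ _ _ (iter_derive g s)); last exact: sg.
by apply: near_eq_iter_derive; apply: filterS fg => y ->.
Qed.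

Lemma smooth_on_ext V W (A : set V) (f g : V -> W) : open A ->
  (forall x, A x -> f x = g x) -> smooth_on A f -> smooth_on A g.
Proof.
move=> oA fg sf; apply: smooth_on_locally => x Ax; exists f.
  by apply: filterS (open_nbhs_nbhs (conj oA Ax)) => y /fg.
by apply: smooth_onS sf => _ ->.
Qed.

Lemma Ck_ext V W k (A : set V) (f g : V -> W) : open A ->
  (forall x, A x -> f x = g x) -> Ck k A f -> Ck k A g.
Proof.
move=> oA; elim: k f g => // k IH f g fg /= [df Cf].
have nfg x : A x -> \near x, f x = g x.
  by move=> Ax; apply: filterS (open_nbhs_nbhs (conj oA Ax)) => y /fg.
split=> [x Ax|v]; first exact: (near_eq_differentiable (nfg x Ax) (df x Ax)).
apply: IH (Cf v) => x Ax; apply: near_eq_derive; exact: nfg.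
Qed.

Lemma Ck_cst V W k (A : set V) (w : W) : Ck k A (fun=> w).
Proof.
elim: k w => //= k IH w; split=> [x _|v]; first exact: differentiable_cst.
rewrite (_ : 'D_v _ = fun=> 0); first exact: IH.
by apply/funext => x; rewrite derive_cst.
Qed.

Lemma CkD V W k (A : set V) (f g : V -> W) : open A ->
  Ck k A f -> Ck k A g -> Ck k A (fun x => f x + g x).
Proof.
move=> oA; elim: k f g => // k IH f g /= [df Cf] [dg Cg]; split=> [x Ax|v].
  by apply: differentiableD; [exact: df|exact: dg].
apply: (@Ck_ext _ _ _ _ (fun x => 'D_v f x + 'D_v g x)) => //; last exact: IH.
by move=> x Ax; rewrite -deriveD//; apply: diff_derivable; [exact: df|exact: dg].
Qed.

Lemma is_diff_linear V W (L : V -> W) x :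
  linear L -> continuous L -> is_diff x L L.
Proof.
move=> lL cL; pose M := GRing.isLinear.Build _ _ _ _ _ lL.
pose L' : {linear V -> W} := HB.pack L M.
by apply: (@DiffDef _ _ _ _ _ L L);
  [exact: (@linear_differentiable _ _ _ L')|exact: (@diff_lin _ _ _ L')].
Qed.

Lemma Ck_linear V W Z k (A : set V) (f : V -> W) (L : W -> Z) : open A ->
  linear L -> continuous L -> Ck k A f -> Ck k A (fun x => L (f x)).
Proof.
move=> oA lL cL; elim: k f => // k IH f /= [df Cf].
have dL y := is_diff_linear y lL cL.
have dLf x : A x -> differentiable (L \o f) x.
  by move=> /df dfx; apply: differentiable_comp => //; exact: ex_diff.
split=> [x /dLf//|v].
apply: (@Ck_ext _ _ _ _ (fun x => L ('D_v f x))) => //; last exact: IH.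
move=> x Ax; rewrite -[X in _ = 'D_v X x]/(L \o f) (deriveE v (df x Ax)) (deriveE v (dLf x Ax)).
rewrite (diff_comp (df x Ax) (@ex_diff _ _ _ _ _ _ _ (dL (f x)))).
by rewrite /= (@diff_val _ _ _ _ _ _ _ (dL (f x))).
Qed.

Lemma is_diff_scale V W (f : V -> R) (g : V -> W) x :
  differentiable f x -> differentiable g x ->
  is_diff x (fun y => f y *: g y) (fun v => f x *: 'd g x v + 'd f x v *: g x).
Proof.
move=> df dg.
(* Scaling is packaged as a continuous bilinear map, so that the product rule is the chain rule
   through a pair followed by this map. *)
have dbl : bilinear_for
    (GRing.Scale.Law.clone _ _ *:%R _) (GRing.Scale.Law.clone _ _ *:%R _)
    (fun (k : R) (w : W) => k *: w).
  split=> [u'|u] a y z /=; first by rewrite scalerDl scalerA.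
  by rewrite scalerDr !scalerA mulrC.
pose BM := bilinear_isBilinear.Build R R W W _ _ _ dbl.
pose B : {bilinear R -> W -> W} := HB.pack (fun (k : R) (w : W) => k *: w) BM.
have cB : continuous (fun p : R * W => B p.1 p.2) by exact: scale_continuous.
have dp := differentiable_pair df dg.
pose P (p : R * W) := B p.1 p.2.
have dP : differentiable P (f x, g x) by exact: (@differentiable_bilin _ _ _ _ B _ cB).
have -> : (fun y => f y *: g y) = P \o (fun y => (f y, g y)) by [].
split; first exact: differentiable_comp dp dP.
rewrite (diff_comp dp dP) (@diff_bilin _ _ _ _ B _ cB) (diff_pair df dg).
by [].
Qed.

Lemma CkZ V W k (A : set V) (f : V -> R) (g : V -> W) : open A ->
  Ck k A f -> Ck k A g -> Ck k A (fun x => f x *: g x).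
Proof.
move=> oA; elim: k f g => // k IH f g Cf Cg.
move: (Cf) (Cg) => /= [df C'f] [dg C'g].
have dfg x : A x -> _ := fun Ax => is_diff_scale (df _ Ax) (dg _ Ax).
split=> [x /dfg Ax|v]; first exact: ex_diff.
apply: (@Ck_ext _ _ _ _ (fun x => f x *: 'D_v g x + 'D_v f x *: g x)) => //.
  move=> x Ax; have dx := dfg x Ax.
  rewrite (deriveE v (dg x Ax)) (deriveE v (df x Ax)).
  by rewrite (deriveE v (@ex_diff _ _ _ _ _ _ _ dx)) (@diff_val _ _ _ _ _ _ _ dx).
by apply: CkD => //; apply: IH => //; exact: CkS.
Qed.

Lemma Ck_sum V W k (A : set V) (I : Type) (r : seq I) (P : pred I)
    (f : I -> V -> W) : open A ->
  (forall i, P i -> Ck k A (f i)) -> Ck k A (fun x => \sum_(i <- r | P i) f i x).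
Proof.
move=> oA Cf.
rewrite (_ : (fun _ => _) = \big[(fun f g x => f x + g x)/(fun=> 0)]_(i <- r | P i) f i).
  by apply: big_ind => //; [exact: Ck_cst|move=> ? ? ? ?; exact: CkD].
apply/funext => x; elim/big_rec2 : _ => // i _ _ _ <-//.
Qed.

(** Finite dimension in the form required by the chain rule: the derivative of g o f becomes a
    finite sum of coordinates of Df times partial derivatives of g along f, to which the induction
    on k applies again. *)
Definition has_coords W := exists (I : finType) (c : I -> W -> R) (e : I -> W),
  (forall i, linear (c i) /\ continuous (c i)) /\
  forall w, w = \sum_i c i w *: e i.

Lemma Ck_comp V W Z k (A : set V) (B : set W) (f : V -> W) (g : W -> Z) :
  has_coords W -> open A -> (forall x, A x -> B (f x)) ->
  Ck k B g -> Ck k A f -> Ck k A (g \o f).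
Proof.
move=> [I [c [e [lc ce]]]] oA AB; elim: k g => // k IH g Cg Cf.
move: (Cg) (Cf) => /= [dg C'g] [df C'f].
split=> [x Ax|v].
  by apply: differentiable_comp; [exact: df|exact/dg/AB].
apply: (@Ck_ext _ _ _ _ (fun x => \sum_i c i ('D_v f x) *: 'D_(e i) g (f x))) => //.
  move=> x Ax; have dfx := df x Ax; have dgx := dg _ (AB x Ax).
  rewrite (deriveE v (differentiable_comp dfx dgx)) (diff_comp dfx dgx).
  rewrite [RHS]/= -(deriveE v dfx).
  transitivity ('d g (f x) (\sum_i c i ('D_v f x) *: e i)); last by rewrite -ce.
  rewrite (linear_sum ('d g (f x))); apply: eq_bigr => i _.
  by rewrite (deriveE (e i) dgx) [RHS]linearZ.
apply: Ck_sum => // i _; apply: CkZ => //.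
  by apply: Ck_linear => //; [exact: (lc i).1|exact: (lc i).2].
by apply: (IH ('D_(e i) g)) => //; exact: CkS.
Qed.

Lemma smooth_on_cst V W (A : set V) (w : W) : smooth_on A (fun=> w).
Proof. by apply/smooth_on_Ck => k; exact: Ck_cst. Qed.

Lemma smooth_onD V W (A : set V) (f g : V -> W) : open A ->
  smooth_on A f -> smooth_on A g -> smooth_on A (fun x => f x + g x).
Proof. by move=> oA /smooth_on_Ck sf /smooth_on_Ck sg; apply/smooth_on_Ck => k; exact: CkD. Qed.

Lemma smooth_onZ V W (A : set V) (f : V -> R) (g : V -> W) : open A ->
  smooth_on A f -> smooth_on A g -> smooth_on A (fun x => f x *: g x).
Proof. by move=> oA /smooth_on_Ck sf /smooth_on_Ck sg; apply/smooth_on_Ck => k; exact: CkZ. Qed.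

Lemma smooth_onM V (A : set V) (f g : V -> R) : open A ->
  smooth_on A f -> smooth_on A g -> smooth_on A (fun x => f x * g x).
Proof. exact: smooth_onZ. Qed.

Lemma smooth_onN V W (A : set V) (f : V -> W) : open A ->
  smooth_on A f -> smooth_on A (fun x => - f x).
Proof.
move=> oA sf; apply: (@smooth_on_ext _ _ _ (fun x => (-1) *: f x)) => //.
  by move=> x _; rewrite scaleN1r.
by apply: smooth_onZ => //; exact: smooth_on_cst.
Qed.

Lemma smooth_onB V W (A : set V) (f g : V -> W) : open A ->
  smooth_on A f -> smooth_on A g -> smooth_on A (fun x => f x - g x).
Proof. by move=> oA sf sg; apply: smooth_onD => //; exact: smooth_onN. Qed.

Lemma smooth_on_sum V W (A : set V) (I : Type) (r : seq I) (P : pred I)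
    (f : I -> V -> W) : open A ->
  (forall i, P i -> smooth_on A (f i)) ->
  smooth_on A (fun x => \sum_(i <- r | P i) f i x).
Proof.
by move=> oA sf; apply/smooth_on_Ck => k; apply: Ck_sum => // i /sf/smooth_on_Ck.
Qed.

Lemma smooth_on_prod V (A : set V) (I : Type) (r : seq I) (P : pred I)
    (f : I -> V -> R) : open A ->
  (forall i, P i -> smooth_on A (f i)) ->
  smooth_on A (fun x => \prod_(i <- r | P i) f i x).
Proof.
move=> oA sf.
rewrite (_ : (fun _ => _) = \big[(fun f g x => f x * g x)/(fun=> 1)]_(i <- r | P i) f i).
  by apply: big_ind => //; [exact: smooth_on_cst|move=> ? ? ? ?; exact: smooth_onM].
apply/funext => x; elim/big_rec2 : _ => // i _ _ _ <-//.
Qed.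

Lemma smooth_on_linear V W Z (A : set V) (f : V -> W) (L : W -> Z) : open A ->
  linear L -> continuous L -> smooth_on A f -> smooth_on A (fun x => L (f x)).
Proof. by move=> oA lL cL /smooth_on_Ck sf; apply/smooth_on_Ck => k; exact: Ck_linear. Qed.

Lemma smooth_on_id V (A : set V) : open A -> smooth_on A (fun x => x).
Proof.
move=> oA; apply/smooth_on_Ck => -[|k]//=; split=> [x _|v]; first exact: ex_diff.
apply: (@Ck_ext _ _ _ _ (fun=> v)) => //; last exact: Ck_cst.
by move=> x _; rewrite derive_id.
Qed.

Lemma smooth_on_comp V W Z (A : set V) (B : set W) (f : V -> W) (g : W -> Z) :
  has_coords W -> open A -> (forall x, A x -> B (f x)) ->
  smooth_on B g -> smooth_on A f -> smooth_on A (g \o f).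
Proof.
move=> cW oA AB /smooth_on_Ck sg /smooth_on_Ck sf; apply/smooth_on_Ck => k.
exact: Ck_comp (sg k) (sf k).
Qed.

End Smooth.

(** * Smoothness of coordinates, pairs, inverses and square roots *)

Section Coordinates.
Context {R : realType}.
Implicit Types V W Z : normedModType R.

Lemma has_coords_real : has_coords R.
Proof.
exists unit, (fun=> id), (fun=> 1); split=> [_|w].
  by split=> // x; exact: cvg_id.
by rewrite big_const cardT/= enumT unlock/= addr0 [_ *: _]mulr1.
Qed.

Lemma coord_linear m n (i : 'I_m) (j : 'I_n) :
  linear (fun M : 'M[R]_(m, n) => M i j).
Proof. by move=> a u v; rewrite !mxE. Qed.

Lemma has_coords_mx m n : has_coords 'M[R]_(m, n).
Proof.
exists ('I_m * 'I_n)%type, (fun i (M : 'M[R]_(m, n)) => M i.1 i.2), (fun i => delta_mx i.1 i.2).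
split=> [[i j]|w]; last by rewrite {1}(matrix_sum_delta w) pair_big.
by split; [exact: coord_linear|exact: coord_continuous].
Qed.

Lemma smooth_on_coord V m n (A : set V) (f : V -> 'M[R]_(m, n)) i j : open A ->
  smooth_on A f -> smooth_on A (fun x => f x i j).
Proof.
by move=> oA; apply: (smooth_on_linear oA (@coord_linear _ _ i j));
  exact: coord_continuous.
Qed.

Lemma smooth_on_mx V m n (A : set V) (f : V -> 'M[R]_(m, n)) : open A ->
  (forall i j, smooth_on A (fun x => f x i j)) -> smooth_on A f.
Proof.
move=> oA sf.
apply: (@smooth_on_ext _ _ _ _ (fun x => \sum_i \sum_j f x i j *: delta_mx i j)) => //.
  by move=> x _; rewrite -matrix_sum_delta.
do 2 (apply: smooth_on_sum => // ? _).
by apply: smooth_onZ => //; exact: smooth_on_cst.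
Qed.

Lemma smooth_on_fst V W Z (A : set Z) (f : Z -> V * W) : open A ->
  smooth_on A f -> smooth_on A (fun x => (f x).1).
Proof.
move=> oA; apply: (smooth_on_linear (L := fst) oA) => //.
by move=> x; exact: cvg_fst.
Qed.

Lemma smooth_on_snd V W Z (A : set Z) (f : Z -> V * W) : open A ->
  smooth_on A f -> smooth_on A (fun x => (f x).2).
Proof.
move=> oA; apply: (smooth_on_linear (L := snd) oA) => //.
by move=> x; exact: cvg_snd.
Qed.

Lemma pairl_continuous V W : continuous (fun v : V => (v, 0 : W)).
Proof. by move=> x; apply: cvg_pair; [exact: cvg_id|exact: cvg_cst]. Qed.

Lemma pairr_continuous V W : continuous (fun w : W => (0 : V, w)).
Proof. by move=> x; apply: cvg_pair; [exact: cvg_cst|exact: cvg_id]. Qed.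

Lemma pairl_linear V W : linear (fun v : V => (v, 0 : W)).
Proof. by move=> a u v; congr pair => /=; rewrite scaler0 addr0. Qed.

Lemma pairr_linear V W : linear (fun w : W => (0 : V, w)).
Proof. by move=> a u v; congr pair => /=; rewrite scaler0 addr0. Qed.

Lemma smooth_on_pair V W Z (A : set Z) (f : Z -> V) (g : Z -> W) : open A ->
  smooth_on A f -> smooth_on A g -> smooth_on A (fun x => (f x, g x)).
Proof.
move=> oA sf sg.
apply: (@smooth_on_ext _ _ _ _ (fun x => (f x, 0) + (0, g x))) => //.
  by move=> x _; congr pair => /=; rewrite ?addr0 ?add0r.
apply: smooth_onD => //.
  by apply: (smooth_on_linear oA (@pairl_linear V W)) sf; exact: pairl_continuous.
by apply: (smooth_on_linear oA (@pairr_linear V W)) sg; exact: pairr_continuous.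
Qed.

Lemma derive_scale_dir W (f : R -> W) (x v : R) : differentiable f x ->
  'D_v f x = v *: 'D_1 f x.
Proof. by move=> df; rewrite !deriveE// -[in LHS](mulr1 v) -linearZ. Qed.

Lemma is_derive1_diff W (f : R -> W) (x : R) (df : W) :
  is_derive x 1 f df -> differentiable f x.
Proof. by move=> ?; apply/derivable1_diffP; exact: ex_derive. Qed.

(** The derivative is a constant times the square of the function itself, so the induction closes
    without computing higher derivatives. *)
Lemma Ck_inv k : Ck k [set x : R | x != 0] (fun x : R => x^-1).
Proof.
have oA : open [set x : R | x != 0] by exact: open_neq.
elim: k => //= k IH; split=> [x /= x0|v]; first exact: differentiable_Rinv.
apply: (@Ck_ext _ _ _ _ _ (fun x : R => (-v) *: (x^-1 *: x^-1))) => //.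
  move=> x /= x0; rewrite (deriveV (f := id) (v := v) x0) ?derive_id//.
  by rewrite -[LHS]/(- v * (x^-1 * x^-1)) -[RHS]/(- x^-2 * v) -exprVn expr2; ring.
apply: CkZ => //; first exact: Ck_cst.
exact: CkZ.
Qed.

Lemma smooth_onV V (A : set V) (f : V -> R) : open A ->
  (forall x, A x -> f x != 0) -> smooth_on A f -> smooth_on A (fun x => (f x)^-1).
Proof.
move=> oA f0; apply: (@smooth_on_comp _ _ _ _ _ [set x : R | x != 0] _ (fun x : R => x^-1)) => //.
  exact: has_coords_real.
by apply/smooth_on_Ck => k; exact: Ck_inv.
Qed.

Lemma Ck_sqrt k : Ck k [set x : R | 0 < x] (fun x : R => Num.sqrt x).
Proof.
have oA : open [set x : R | 0 < x] by exact: open_gt.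
have df (x : R) : 0 < x -> differentiable (fun x : R => Num.sqrt x) x.
  by move=> x0; exact: is_derive1_diff (is_derive1_sqrt x0).
elim: k => //= k IH; split=> [x /= x0|v]; first exact: df.
apply: (@Ck_ext _ _ _ _ _ (fun x : R => (v / 2) *: (Num.sqrt x)^-1)) => //.
  move=> x /= x0; rewrite (derive_scale_dir _ (df x x0)) derive_sqrt//.
  by rewrite -[LHS]/(_ * _) -[RHS]/(_ * _) invfM mulrA.
apply: CkZ => //; first exact: Ck_cst.
apply: (@Ck_comp _ _ _ _ _ _ [set x : R | x != 0] _ (fun x : R => x^-1)) => //.
- exact: has_coords_real.
- by move=> x /= x0; rewrite gt_eqF// sqrtr_gt0.
exact: Ck_inv.
Qed.

Lemma smooth_on_sqrt V (A : set V) (f : V -> R) : open A ->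
  (forall x, A x -> 0 < f x) -> smooth_on A f ->
  smooth_on A (fun x => Num.sqrt (f x)).
Proof.
move=> oA f0; apply: (@smooth_on_comp _ _ _ _ _ [set x : R | 0 < x] _ (fun x : R => Num.sqrt x))
  => //.
  exact: has_coords_real.
by apply/smooth_on_Ck => k; exact: Ck_sqrt.
Qed.

Lemma smooth_on_half_line V (A : set V) (a : R -> R) (f : V -> R) : open A ->
  smooth_half_line a -> (forall x, A x -> 0 <= f x) -> smooth_on A f ->
  smooth_on A (fun x => a (f x)).
Proof.
move=> oA [F [sF aF]] f0 sf.
apply: (@smooth_on_ext _ _ _ _ (F \o f)) => //.
  by move=> x Ax /=; rewrite aF//; exact: f0.
by apply: (smooth_on_comp has_coords_real oA _ sF).
Qed.

End Coordinates.

(** * A smooth function on the line that vanishes on a half-line *)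

Section Bump.
Context {R : realType}.

(* The span of these functions is closed under differentiation. *)
Definition flat (m : nat) (t : R) : R := if 0 < t then t ^- m * expR (- t^-1) else 0.

(** The exponential of 1/t dominates its series term of degree m + 3; against t^-(m+1) this leaves
    two powers of t, enough to squeeze the function to 0 at the origin. *)
Lemma flat_le m (t : R) : `|flat m.+1 t| <= (m.+3)`!%:R * t ^+ 2.
Proof.
rewrite /flat; case: ifPn => [t0|_]; last first.
  by rewrite normr0 mulr_ge0// sqr_ge0.
rewrite ger0_norm; last by rewrite mulr_ge0 ?expR_ge0// invr_ge0 exprn_ge0 ?ltW.
have t1 : 0 <= t^-1 by rewrite invr_ge0 ltW.
have := expR_ge1Dxn m.+2 t1; rewrite expRN => H.
have {}H : t^-1 ^+ m.+3 / (m.+3)`!%:R <= expR t^-1 by apply: le_trans H; rewrite lerDr.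
rewrite ler_pdivrMr ?expR_gt0//.
have f0 : 0 < (m.+3)`!%:R :> R by rewrite ltr0n fact_gt0.
rewrite -(ler_pM2l (mulr_gt0 f0 (exprn_gt0 2 t0))) in H.
apply: le_trans H.
rewrite -exprVn le_eqVlt; apply/orP; left; apply/eqP.
rewrite [t^-1 ^+ m.+3]exprS [t^-1 ^+ m.+2]exprS.
have t00 : t != 0 by rewrite gt_eqF.
move: (t^-1 ^+ m.+1) (m.+3)`!%:R {t1 t0} (lt0r_neq0 f0) t00 => x f {}f0 t0.
by field; rewrite f0.
Qed.

Lemma is_derive_flat m (t : R) : is_derive t 1 (flat m) (flat m.+2 t - m%:R * flat m.+1 t).
Proof.
have [t0|t0|->] := ltgtP t 0.
- apply: (@near_eq_is_derive _ _ _ (fun=> 0)).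
    near=> s; rewrite /flat ifF//; apply/negbTE; rewrite -leNgt ltW//.
    by near: s; exact: lt_nbhsl.
  rewrite /flat !ifF ?mulr0 ?subr0; do ?by apply/negbTE; rewrite -leNgt ltW.
  exact: is_derive_cst.
- apply: (@near_eq_is_derive R R R (fun s : R => s ^- m * expR (- s^-1))).
    near=> s; rewrite /flat ifT//.
    by near: s; exact: lt_nbhsr.
  have tn0 : t != 0 by rewrite gt_eqF.
  have dV : is_derive t 1 (fun s : R => s^-1) (- t^-2).
    apply: is_derive_eq (is_deriveV (f := id) _ _) _ => //.
    by rewrite -[LHS]/(_ * _) mulr1.
  have dX := is_deriveX m dV.
  have dE : is_derive t 1 (fun s => expR (- s^-1)) (expR (- t^-1) * (t^-2)).
    apply: (is_derive1_comp (f := expR) (g := fun s => - s^-1)).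
    by rewrite -[t^-2]opprK; exact: is_deriveN.
  have := is_deriveM dX dE; set D := (X in is_derive t 1 _ X) => H.
  rewrite /flat !t0 [X in is_derive _ _ X _](_ : _ =
    ((fun s => s^-1) ^+ m * (fun s : R => expR (- s^-1)))); last first.
    by apply/funext => s; rewrite !fctE exprVn.
  apply: is_derive_eq H _; rewrite /D !fctE /GRing.scale/= -!exprVn.
  case: m {dX D} => [|m]; first by rewrite !expr0 expr2; ring.
  by rewrite /= !exprS expr0; ring.
(* At the origin the difference quotient is again a member of the family, and [flat_le] bounds
   exactly this index. *)
have fS h : h^-1 * flat m h = flat m.+1 h.
  rewrite /flat; case: ifPn => _; last by rewrite mulr0.
  by rewrite -!exprVn exprS mulrA.
have f0 k : flat k 0 = 0 by rewrite /flat ltxx.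
rewrite !f0 mulr0 subr0.
have H : (fun h : R => h^-1 *: (flat m (h *: 1 + 0) - flat m 0)) @ 0^' --> (0 : R).
  rewrite [X in X @ _](_ : _ = flat m.+1); last first.
    by apply/funext => h; rewrite f0 subr0 addr0 -fS /GRing.scale/= mulr1.
  apply: norm_cvg0; apply: (squeeze_cvgr (f := cst 0) (h := fun h => (m.+3)`!%:R * h ^+ 2)).
  - by near=> h; rewrite normr_ge0 flat_le.
  - exact: cvg_cst.
  rewrite -[X in _ --> X](mulr0 ((m.+3)`!%:R)).
  apply: cvgM; first exact: cvg_cst.
  rewrite [X in _ --> X](_ : 0 = 0 ^+ 2); last by rewrite expr0n.
  apply: cvg_within_filter; exact: exprn_continuous.
split; first by apply/cvg_ex; exists 0.
exact: (cvg_lim _ H).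
Unshelve. all: by end_near. Qed.

Lemma Ck_flat k m : Ck k setT (flat m).
Proof.
elim: k m => //= k IH m.
have d t : differentiable (flat m) t by exact: is_derive1_diff (is_derive_flat m t).
split=> // v.
apply: (@Ck_ext _ _ _ _ _ (fun t => v *: (flat m.+2 t + (- m%:R) *: flat m.+1 t))).
- exact: openT.
- move=> t _; rewrite derive_scale_dir// (@derive_val _ _ _ _ _ _ _ (is_derive_flat m t)).
  by rewrite /GRing.scale/= mulNr.
apply: CkZ; [exact: openT|exact: Ck_cst|].
apply: CkD; [exact: openT|exact: IH|].
by apply: CkZ; [exact: openT|exact: Ck_cst|exact: IH].
Qed.

End Bump.

(** * Symmetry of second derivatives, bump functions *)

Section Schwarz.
Context {R : realType}.
Implicit Types V W Z : normedModType R.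

Lemma is_derive_diff V W (f : V -> W) (x v : V) : differentiable f x ->
  is_derive x v f ('d f x v).
Proof. by move=> df; split; [exact: diff_derivable|rewrite deriveE]. Qed.

Lemma is_derive_comp V W Z (f : V -> W) (g : W -> Z) (x v : V) :
  differentiable f x -> differentiable g (f x) ->
  is_derive x v (g \o f) ('D_('D_v f x) g (f x)).
Proof.
move=> df dg; have dgf := differentiable_comp df dg.
apply: is_derive_eq (is_derive_diff v dgf) _.
by rewrite (diff_comp df dg) (deriveE _ dg) (deriveE _ df).
Qed.

Lemma derive_comp V W Z (f : V -> W) (g : W -> Z) (x v : V) :
  differentiable f x -> differentiable g (f x) ->
  'D_v (g \o f) x = 'D_('D_v f x) g (f x).
Proof. by move=> df dg; apply: derive_val; exact: is_derive_comp. Qed.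

Lemma is_derive_line V W (F : V -> W) (y u : V) (s : R) :
  differentiable F (y + s *: u) ->
  is_derive s 1 (fun s : R => F (y + s *: u)) ('D_u F (y + s *: u)).
Proof.
move=> dF; pose l (s : R) := y + s *: u.
have dl : is_diff s l (fun k : R => k *: u).
  by apply: is_diff_eq; rewrite add0r.
have := @is_derive_comp _ _ _ l F s 1 (@ex_diff _ _ _ _ _ _ _ dl) dF.
by rewrite (deriveE _ (@ex_diff _ _ _ _ _ _ _ dl)) (@diff_val _ _ _ _ _ _ _ dl) scale1r.
Qed.

Lemma MVT_line V (F : V -> R) (y u : V) (t : R) : 0 < t ->
  (forall s, 0 <= s <= t -> differentiable F (y + s *: u)) ->
  exists2 s, 0 < s < t & F (y + t *: u) - F y = t * 'D_u F (y + s *: u).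
Proof.
move=> t0 dF.
have [||s] := @MVT R (fun s : R => F (y + s *: u)) (fun s => 'D_u F (y + s *: u)) 0 t t0.
- move=> s; rewrite in_itv/= => /andP[s0 st].
  by apply: is_derive_line; apply: dF; rewrite !ltW.
- apply: derivable_within_continuous => s; rewrite in_itv/= => /dF dFs.
  exact: (@ex_derive _ _ _ _ _ _ _ (is_derive_line dFs)).
rewrite in_itv/= => st; rewrite scale0r addr0 subr0 => ->.
by exists s => //; rewrite mulrC.
Qed.

(** The mean value theorem is used twice: along u for y |-> f (y + t v) - f y, then along v for
    ['D_u f]. *)
Let second_diff V (A : set V) (f : V -> R) (x u v : V) (t : R) :
  smooth_on A f -> 0 < t ->
  (forall a b, 0 <= a <= t -> 0 <= b <= t -> A (x + a *: u + b *: v)) ->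
  exists a b, [/\ 0 < a < t, 0 < b < t &
    f (x + t *: u + t *: v) - f (x + t *: u) - (f (x + t *: v) - f x) =
    t ^+ 2 * 'D_v ('D_u f) (x + a *: u + b *: v)].
Proof.
move=> sf t0 At; have tt : 0 <= t <= t by rewrite lexx ltW.
have t00 : (0 : R) <= 0 <= t by apply/andP; split=> //; exact: ltW.
pose F y := f (y + t *: v) - f y.
have dsh y : differentiable (fun y : V => y + t *: v) y by [].
have dF a : 0 <= a <= t ->
    is_derive (x + a *: u) u F ('D_u f (x + a *: u + t *: v) - 'D_u f (x + a *: u)).
  move=> at_; have d0 : differentiable f (x + a *: u).
    by have := smooth_on_diff sf (At a 0 at_ t00); rewrite scale0r addr0.
  have d1 := smooth_on_diff sf (At a t at_ tt).
  apply: is_deriveB; last exact/derivableP/diff_derivable.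
  apply: is_derive_eq (is_derive_comp u (dsh _) d1) _.
  congr ('D__ _ _); rewrite deriveD; [|exact: derivable_id|exact: derivable_cst].
  by rewrite derive_id derive_cst addr0.
have dF' a : 0 <= a <= t -> differentiable F (x + a *: u).
  move=> at_; have d0 : differentiable f (x + a *: u).
    by have := smooth_on_diff sf (At a 0 at_ t00); rewrite scale0r addr0.
  apply: differentiableB d0.
  exact: (differentiable_comp (dsh _) (smooth_on_diff sf (At a t at_ tt))).
have [a at_ Fa] := MVT_line t0 dF'.
have at' : 0 <= a <= t by case/andP: at_ => /ltW-> /ltW->.
have [b bt fb] := @MVT_line V ('D_u f) (x + a *: u) v t t0
  (fun b bt => smooth_on_diff (smooth_on_derive u sf) (At a b at' bt)).
exists a, b; split => //.
transitivity (F (x + t *: u) - F x); first by rewrite /F.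
by rewrite Fa (@derive_val _ _ _ _ _ _ _ (dF a at')) fb expr2 mulrA.
Qed.

(** The second difference over a parallelogram is symmetric in u and v, so the two mixed derivatives
    agree at two points close to x; their continuity carries the equality to x. *)
Lemma derive_sym V (A : set V) (f : V -> R) (x u v : V) : open A -> A x ->
  smooth_on A f -> 'D_u ('D_v f) x = 'D_v ('D_u f) x.
Proof.
move=> oA Ax sf.
have cont a b : {for x, continuous ('D_a ('D_b f))}.
  apply: differentiable_continuous.
  by apply: smooth_on_diff Ax; do 2 apply: smooth_on_derive.
apply/eqP; rewrite -subr_eq0 -normr_le0; apply/ler_addgt0Pl => e e0; rewrite addr0.
have e2 : 0 < e / 2 by rewrite divr_gt0.
have /cvgrPdist_le /(_ _ e2) H1 := cont u v.
have /cvgrPdist_le /(_ _ e2) H2 := cont v u.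
have H3 := open_nbhs_nbhs (conj oA Ax).
pose B1 := [set y | `|'D_u ('D_v f) x - 'D_u ('D_v f) y| <= e / 2].
pose B2 := [set y | `|'D_v ('D_u f) x - 'D_v ('D_u f) y| <= e / 2].
have : nbhs x (A `&` (B1 `&` B2)) by apply: filterI H3 _; apply: filterI; [exact: H1|exact: H2].
move=> /nbhs_ballP[r /= r0 Hr].
(* The side t keeps the parallelogram within distance r / 2 of x; the summand 1 makes m positive
   even when u = v = 0. *)
pose m := `|u| + `|v| + 1; have m0 : 0 < m by rewrite ltr_wpDl// addr_ge0.
pose t := r / 2 / m; have t0 : 0 < t by rewrite !divr_gt0.
have inball a b : 0 <= a <= t -> 0 <= b <= t -> ball x r (x + a *: u + b *: v).
  move=> /andP[a0 at_] /andP[b0 bt]; rewrite -ball_normE/= -addrA opprD addNKr normrN.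
  apply: le_lt_trans (ler_normD _ _) _; rewrite !normrZ !ger0_norm//.
  apply: (@le_lt_trans _ _ (t * m)).
    rewrite /m 2!mulrDr mulr1 -[leLHS]addr0 lerD//; last exact: ltW.
    by rewrite lerD// ler_wpM2r.
  by rewrite /t divfK ?gt_eqF// ltr_pdivrMr// ltr_pMr// ltr1n.
have [a [b [at_ bt E1]]] := @second_diff V A f x u v t sf t0
   (fun a b at_ bt => (Hr _ (inball a b at_ bt)).1).
have [b' [a' [bt' at' E2]]] := @second_diff V A f x v u t sf t0
   (fun a b at_ bt => ltac:(rewrite addrAC; exact: (Hr _ (inball b a bt at_)).1)).
have wt c : 0 < c < t -> 0 <= c <= t by move=> /andP[/ltW-> /ltW->].
have [_ [_ K2]] := Hr _ (inball a b (wt _ at_) (wt _ bt)).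
have [_ [K1 _]] := Hr _ (inball a' b' (wt _ at') (wt _ bt')).
have E : 'D_v ('D_u f) (x + a *: u + b *: v) = 'D_u ('D_v f) (x + a' *: u + b' *: v).
  apply: (mulfI (lt0r_neq0 (exprn_gt0 2 t0))); rewrite -E1 [x + a' *: u + _]addrAC -E2.
  by rewrite [x + t *: v + _]addrAC; ring.
move: K1 K2; rewrite /B1 /B2 /= E.
move: ('D_u ('D_v f) x) ('D_v ('D_u f) x) ('D_u ('D_v f) _) => p q w.
by rewrite !ler_norml => /andP[? ?] /andP[? ?]; apply/andP; split; lra.
Qed.

End Schwarz.

Section BumpRow.
Context {R : realType} {n : nat}.

(** The Euclidean square distance makes the argument a polynomial. Row vectors carry the sup norm,
    and the Euclidean ball lies in the sup ball of the same radius, so the support is controlled by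
    [closed_ball]. *)
Definition bump_function (p : 'rV[R]_n) (r : R) (x : 'rV[R]_n) : R :=
  flat 0 (r ^+ 2 - \sum_i (x 0 i - p 0 i) ^+ 2).

Lemma smooth_on_bump p r : smooth_on setT (bump_function p r).
Proof.
have oT := @openT 'rV[R]_n.
apply: (smooth_on_comp has_coords_real oT (B := setT) (g := flat 0)) => //.
  by apply/smooth_on_Ck => k; exact: Ck_flat.
apply: smooth_onB => //; first exact: smooth_on_cst.
apply: smooth_on_sum => // i _.
have s : smooth_on setT (fun x : 'rV[R]_n => x 0 i - p 0 i).
  by apply: smooth_onB; [|apply: smooth_on_coord => //; exact: smooth_on_id|exact: smooth_on_cst].
by apply: (@smooth_on_ext _ _ _ _ _ _ oT _ (smooth_onM oT s s)) => x _.
Qed.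

Lemma bump_center p r : 0 < r -> bump_function p r p != 0.
Proof.
move=> r0; rewrite /bump_function big1 => [|i _]; last by rewrite subrr expr0n.
by rewrite subr0 /flat exprn_gt0// expr0 invr1 mul1r gt_eqF ?expR_gt0.
Qed.

Lemma bump_eq0 p r x : 0 < r -> ~ closed_ball p r x -> bump_function p r x = 0.
Proof.
move=> r0; rewrite closed_ballE// /closed_ball_/= => /negP; rewrite -ltNge => H.
rewrite /bump_function /flat ifF//; apply/negbTE; rewrite -leNgt subr_le0.
have [i Hi] : exists i, r <= `|p 0 i - x 0 i|.
  apply/not_existsP => K; move: H; rewrite ltNge => /negP; apply.
  rewrite [leLHS]/Num.Def.normr/= mx_normrE; apply: bigmax_le; first exact: ltW.
  by move=> [a b] _ /=; rewrite ord1 !mxE; have /negP := K b; rewrite -ltNge => /ltW.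
rewrite (bigD1 i)//= -[leLHS]addr0 lerD ?sumr_ge0// => [|j _]; last exact: sqr_ge0.
by rewrite -[leRHS]real_normK ?num_real// distrC ler_sqr ?nnegrE// ltW.
Qed.

End BumpRow.

(** * Local Riemannian geometry *)

Section BilinearDerivative.
Context {R : realType} {n : nat}.
Implicit Types (V : normedModType R).
Local Notation rV := 'rV[R]_n.

Lemma is_derive_mxP V p q (M : V -> 'M[R]_(p, q)) (z v : V) dM :
  is_derive z v M dM <-> forall i j, is_derive z v (fun w => M w i j) (dM i j).
Proof.
split=> [[dv <-] i j|H].
  by split; [exact: (derivable_mxP M z v).1|rewrite derive_mx// mxE].
have dv : derivable M z v by apply/derivable_mxP => i j; exact: ex_derive.
split=> //; rewrite derive_mx//; apply/matrixP => i j; rewrite mxE.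
exact: derive_val.
Qed.

Lemma is_derive_sumE V (W : normedModType R) m (h : 'I_m -> V -> W) (z v : V) dh :
  (forall i, is_derive z v (h i) (dh i)) ->
  is_derive z v (fun w => \sum_i h i w) (\sum_i dh i).
Proof. by move=> H; rewrite -fct_sumE; exact: is_derive_sum. Qed.

Lemma is_deriveME V (f g : V -> R) (z v : V) (df dg : R) :
  is_derive z v f df -> is_derive z v g dg ->
  is_derive z v (fun w => f w * g w) (df * g z + f z * dg).
Proof.
move=> Hf Hg; apply: is_derive_eq (is_deriveM Hf Hg) _.
by rewrite /GRing.scale/= addrC [g z * _]mulrC.
Qed.

(** Gram matrices and, for each upper index, Christoffel symbols have this shape, so one product
    rule with moving coefficients serves both. *)
Definition bil (A : 'I_n -> 'I_n -> R) (u v : rV) : R :=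
  \sum_i \sum_j A i j * u 0 i * v 0 j.

Lemma is_derive_bil V (A : V -> 'I_n -> 'I_n -> R) (X Y : V -> rV) (z v : V) dA dX dY :
  (forall i j, is_derive z v (fun w => A w i j) (dA i j)) ->
  is_derive z v X dX -> is_derive z v Y dY ->
  is_derive z v (fun w => bil (A w) (X w) (Y w))
    (bil dA (X z) (Y z) + bil (A z) dX (Y z) + bil (A z) (X z) dY).
Proof.
move=> HA /is_derive_mxP HX /is_derive_mxP HY.
rewrite /bil -!big_split/=; apply: is_derive_sumE => i.
rewrite -!big_split/=; apply: is_derive_sumE => j.
apply: is_derive_eq (is_deriveME (is_deriveME (HA i j) (HX 0 i)) (HY 0 j)) _.
by rewrite mulrDl.
Qed.

Lemma bilDl A u u' v : bil A (u + u') v = bil A u v + bil A u' v.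
Proof.
rewrite /bil -big_split; apply: eq_bigr => i _; rewrite -big_split.
by apply: eq_bigr => j _; rewrite mxE/=; ring.
Qed.

Lemma bilDr A u v v' : bil A u (v + v') = bil A u v + bil A u v'.
Proof.
rewrite /bil -big_split; apply: eq_bigr => i _; rewrite -big_split.
by apply: eq_bigr => j _; rewrite mxE/=; ring.
Qed.

Lemma bilZl A c u v : bil A (c *: u) v = c * bil A u v.
Proof.
rewrite /bil mulr_sumr; apply: eq_bigr => i _; rewrite mulr_sumr.
by apply: eq_bigr => j _; rewrite mxE/=; ring.
Qed.

Lemma bilZr A c u v : bil A u (c *: v) = c * bil A u v.
Proof.
rewrite /bil mulr_sumr; apply: eq_bigr => i _; rewrite mulr_sumr.
by apply: eq_bigr => j _; rewrite mxE/=; ring.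
Qed.

Lemma eq_bil A B u v : (forall i j, A i j = B i j) -> bil A u v = bil B u v.
Proof. by move=> AB; apply: eq_bigr => i _; apply: eq_bigr => j _; rewrite AB. Qed.

Lemma bilDc A B u v : bil (fun i j => A i j + B i j) u v = bil A u v + bil B u v.
Proof.
rewrite /bil -big_split; apply: eq_bigr => i _; rewrite -big_split.
by apply: eq_bigr => j _ /=; ring.
Qed.

Lemma bilZc c A u v : bil (fun i j => c * A i j) u v = c * bil A u v.
Proof.
rewrite /bil mulr_sumr; apply: eq_bigr => i _; rewrite mulr_sumr.
by apply: eq_bigr => j _ /=; ring.
Qed.

Lemma bil0l A v : bil A 0 v = 0.
Proof. by have := bilZl A 0 0 v; rewrite scale0r mul0r. Qed.

Lemma bil0r A v : bil A v 0 = 0.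
Proof. by have := bilZr A 0 v 0; rewrite scale0r mul0r. Qed.

Lemma deriveDdir V (W : normedModType R) (f : V -> W) x p q : differentiable f x ->
  'D_(p + q) f x = 'D_p f x + 'D_q f x.
Proof. by move=> df; rewrite !deriveE// linearD. Qed.

Lemma deriveZdir V (W : normedModType R) (f : V -> W) x c p : differentiable f x ->
  'D_(c *: p) f x = c *: 'D_p f x.
Proof. by move=> df; rewrite !deriveE// linearZ. Qed.

Lemma derive_dirE (W : normedModType R) (f : rV -> W) x p : differentiable f x ->
  'D_p f x = \sum_i p 0 i *: 'D_(delta_mx 0 i) f x.
Proof.
move=> df; rewrite deriveE// [in LHS](row_sum_delta p) linear_sum; apply: eq_bigr => i _.
by rewrite linearZ/= deriveE.
Qed.

End BilinearDerivative.

Section Determinant.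
Context {R : realType} {V : normedModType R}.

Lemma smooth_on_det n (A : set V) (M : V -> 'M[R]_n) : open A ->
  (forall i j, smooth_on A (fun x => M x i j)) -> smooth_on A (fun x => \det (M x)).
Proof.
move=> oA sM; rewrite /determinant; apply: smooth_on_sum => // s _.
by apply: smooth_onM => //; [exact: smooth_on_cst|exact: smooth_on_prod].
Qed.

(** Cramer's rule: each entry is a cofactor divided by the determinant. *)
Lemma smooth_on_invmx n (A : set V) (M : V -> 'M[R]_n) i j : open A ->
  (forall i j, smooth_on A (fun x => M x i j)) -> (forall x, A x -> M x \in unitmx) ->
  smooth_on A (fun x => invmx (M x) i j : R).
Proof.
move=> oA sM uM.
apply: (@smooth_on_ext R V R A (fun x => (\det (M x))^-1 * cofactor (M x) j i)) => //.
  by move=> x Ax; rewrite /invmx uM// !mxE.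
apply: smooth_onM => //.
  by apply: smooth_onV => //; [move=> x /uM; rewrite unitmxE unitfE|exact: smooth_on_det].
rewrite /cofactor; apply: smooth_onM => //; first exact: smooth_on_cst.
apply: smooth_on_det => // a b.
by rewrite (_ : (fun x => _) = (fun x => M x (lift j a) (lift i b)))//;
  apply/funext => x; rewrite !mxE.
Qed.

End Determinant.

(* Locked, like curv and hcov below: otherwise unification unfolds derivatives
   and the sum defining riemann. *)
HB.lock Definition dchristoffel_form (R : realType) (n : nat) (G : 'rV[R]_n -> 'M[R]_n)
  (x p u v : 'rV[R]_n) : 'rV[R]_n := 'D_p (fun z => christoffel_form G z u v) x.

HB.lock Definition curv (R : realType) (n : nat) (G : 'rV[R]_n -> 'M[R]_n)
  (x X Y Z : 'rV[R]_n) : 'rV[R]_n := riemann G x X Y Z.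

(** The data of one chart. Curvature and the contact identities are treated at this level; the
    manifold returns only for global fields. *)
Record local_metric (R : realType) (n : nat) (O : set 'rV[R]_n)
    (G : 'rV[R]_n -> 'M[R]_n) : Prop := LocalMetric {
  lm_open : open O ;
  lm_smooth : smooth_on O G ;
  lm_sym : forall x, O x -> (G x)^T = G x ;
  lm_pos : forall x (u : 'rV[R]_n), O x -> u != 0 -> 0 < gform G x u u }.

Ltac row_ring :=
  repeat match goal with
  | |- context [christoffel_form ?G ?x ?u ?v] => generalize (christoffel_form G x u v); intro
  | |- context [dchristoffel_form ?G ?x ?p ?u ?v] => generalize (dchristoffel_form G x p u v); intro
  end;
  apply/rowP => ?; rewrite !mxE; ring.

(** * Christoffel symbols and the symmetries of the curvature *)

Section LocalGeometry.
Context {R : realType} {n : nat}.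
Local Notation rV := 'rV[R]_n.
Implicit Types (V : normedModType R).
Variables (O : set rV) (G : rV -> 'M[R]_n).
Hypothesis lm : local_metric O G.
Let oO := lm_open lm.
Let sG := lm_smooth lm.
Let symG := lm_sym lm.
Let posG := lm_pos lm.
Local Notation Gam := (christoffel_form G).

Lemma gformE x u v : gform G x u v = bil (G x) u v.
Proof.
rewrite /gform /bil mxE exchange_big; apply: eq_bigr => j _ /=.
by rewrite mxE mulr_suml mxE; apply: eq_bigr => i _; rewrite [u 0 i * _]mulrC.
Qed.

Lemma gformDl x u u' v : gform G x (u + u') v = gform G x u v + gform G x u' v.
Proof. by rewrite !gformE bilDl. Qed.
Lemma gformDr x u v v' : gform G x u (v + v') = gform G x u v + gform G x u v'.
Proof. by rewrite !gformE bilDr. Qed.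
Lemma gformZl x c u v : gform G x (c *: u) v = c * gform G x u v.
Proof. by rewrite !gformE bilZl. Qed.
Lemma gformZr x c u v : gform G x u (c *: v) = c * gform G x u v.
Proof. by rewrite !gformE bilZr. Qed.
Lemma gformNl x u v : gform G x (- u) v = - gform G x u v.
Proof. by rewrite -scaleN1r gformZl mulN1r. Qed.
Lemma gformNr x u v : gform G x u (- v) = - gform G x u v.
Proof. by rewrite -scaleN1r gformZr mulN1r. Qed.
Lemma gform0l x v : gform G x 0 v = 0.
Proof. by rewrite -(scale0r 0) gformZl mul0r. Qed.
Lemma gform0r x v : gform G x v 0 = 0.
Proof. by rewrite -(scale0r 0) gformZr mul0r. Qed.

Lemma gform_sym x u v : O x -> gform G x u v = gform G x v u.
Proof.
move=> Ox; rewrite !gformE /bil exchange_big; apply: eq_bigr => i _; apply: eq_bigr => j _.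
by rewrite -{1}(symG Ox) mxE mulrAC.
Qed.

Lemma gform_eq0 x u : O x -> (gform G x u u == 0) = (u == 0).
Proof.
move=> Ox; apply/eqP/eqP => [|->]; last by rewrite gform0l.
by apply: contra_eq => /(posG Ox) /gt_eqF ->.
Qed.

Lemma gform_inj x u v : O x -> (forall w, gform G x u w = gform G x v w) -> u = v.
Proof.
move=> Ox H; apply/eqP; rewrite -subr_eq0 -(gform_eq0 _ Ox) gformDl gformNl H.
by rewrite subrr.
Qed.

Lemma gram_unit x : O x -> G x \in unitmx.
Proof.
move=> Ox; rewrite -row_free_unit; apply: inj_row_free => u uG.
by apply/eqP; rewrite -(gform_eq0 _ Ox) /gform uG mul0mx mxE.
Qed.

Lemma smooth_gram_entry i j : smooth_on O (fun x => G x i j).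
Proof. exact: smooth_on_coord. Qed.

Lemma smooth_christoffel k i j : smooth_on O (fun x => christoffel G x k i j).
Proof.
apply: smooth_onM => //; first exact: smooth_on_cst.
apply: smooth_on_sum => // l _; apply: smooth_onM => //.
  by apply: smooth_on_invmx => //; [exact: smooth_gram_entry|exact: gram_unit].
by apply: smooth_onB => //; [apply: smooth_onD => //|];
  apply: smooth_on_derive; exact: smooth_gram_entry.
Qed.

Lemma derive_gram_sym p x i j : O x ->
  'D_p (fun z => G z i j) x = 'D_p (fun z => G z j i) x.
Proof.
move=> Ox; apply: near_eq_derive.
by apply: filterS (open_nbhs_nbhs (conj oO Ox)) => z Oz; rewrite -{1}(symG Oz) mxE.
Qed.

Lemma christoffel_sym x k i j : O x -> christoffel G x k i j = christoffel G x k j i.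
Proof.
move=> Ox; congr (_ * _); apply: eq_bigr => l _; congr (_ * _).
by rewrite [X in X - _]addrC (derive_gram_sym _ i j Ox).
Qed.

Lemma Gam_coord x u v k : Gam x u v 0 k = bil (christoffel G x k) u v.
Proof. by rewrite mxE. Qed.

Lemma GamC x u v : O x -> Gam x u v = Gam x v u.
Proof.
move=> Ox; apply/rowP => k; rewrite !Gam_coord /bil exchange_big.
apply: eq_bigr => i _; apply: eq_bigr => j _.
by rewrite christoffel_sym// mulrAC.
Qed.

Lemma GamDl x u u' v : Gam x (u + u') v = Gam x u v + Gam x u' v.
Proof. by apply/rowP => k; rewrite [in RHS]mxE !Gam_coord bilDl. Qed.
Lemma GamDr x u v v' : Gam x u (v + v') = Gam x u v + Gam x u v'.
Proof. by apply/rowP => k; rewrite [in RHS]mxE !Gam_coord bilDr. Qed.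
Lemma GamZl x c u v : Gam x (c *: u) v = c *: Gam x u v.
Proof. by apply/rowP => k; rewrite [in RHS]mxE !Gam_coord bilZl. Qed.
Lemma GamZr x c u v : Gam x u (c *: v) = c *: Gam x u v.
Proof. by apply/rowP => k; rewrite [in RHS]mxE !Gam_coord bilZr. Qed.
Lemma GamNr x u v : Gam x u (- v) = - Gam x u v.
Proof. by rewrite -scaleN1r GamZr scaleN1r. Qed.
Lemma Gam0l x v : Gam x 0 v = 0.
Proof. by have := GamZl x 0 0 v; rewrite !scale0r. Qed.
Lemma Gam0r x v : Gam x v 0 = 0.
Proof. by have := GamZr x 0 v 0; rewrite !scale0r. Qed.

Lemma christoffel_lower x m i j : O x ->
  \sum_k G x m k * christoffel G x k i j =
  2^-1 * ('D_(delta_mx 0 i) (fun z => G z j m) x +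
          'D_(delta_mx 0 j) (fun z => G z i m) x -
          'D_(delta_mx 0 m) (fun z => G z i j) x).
Proof.
move=> Ox; rewrite /christoffel.
pose D l := 'D_(delta_mx 0 i) (fun z => G z j l) x +
  'D_(delta_mx 0 j) (fun z => G z i l) x - 'D_(delta_mx 0 l) (fun z => G z i j) x.
rewrite -/(D m).
transitivity (\sum_l 2^-1 * ((G x *m invmx (G x)) m l * D l)).
  under eq_bigr => k _ do rewrite mulrCA !mulr_sumr.
  rewrite exchange_big; apply: eq_bigr => l _ /=.
  by rewrite mxE mulr_suml mulr_sumr; apply: eq_bigr => k _; rewrite -/(D l); ring.
rewrite mulmxV ?gram_unit// (bigD1 m)//= big1 => [|l ne_lm]; rewrite !mxE.
  by rewrite eqxx addr0 mul1r.
by rewrite eq_sym (negbTE ne_lm) mul0r mulr0.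
Qed.

Lemma derive_gram x m i j : O x ->
  'D_(delta_mx 0 i) (fun z => G z j m) x =
  \sum_k G x m k * christoffel G x k i j + \sum_k G x j k * christoffel G x k i m.
Proof.
move=> Ox; rewrite !christoffel_lower//.
by rewrite (derive_gram_sym (delta_mx 0 i) m j Ox)//; field.
Qed.

(** Metric compatibility of the connection on fields with constant components; every later
    derivative of an inner product splits into covariant derivatives through it. *)
Lemma gram_compat_Gam x p u v : O x ->
  bil (fun i j => 'D_p (fun z => G z i j) x) u v =
  gform G x (Gam x p u) v + gform G x u (Gam x p v).
Proof.
move=> Ox.
(* Pairing with a basis vector lowers the upper index, which gives the sums that appear in
   [derive_gram]. *)
have low w j : gform G x (Gam x p w) (delta_mx 0 j) =
    \sum_m \sum_i (\sum_k G x j k * christoffel G x k i m) * p 0 i * w 0 m.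
  rewrite gformE /bil.
  transitivity (\sum_k G x j k * Gam x p w 0 k).
    apply: eq_bigr => k _; rewrite (bigD1 j)//= big1 => [|l lj].
      by rewrite [delta_mx _ _ _ _]mxE !eqxx mulr1 addr0 -{1}(symG Ox) [_^T _ _]mxE.
    by rewrite [delta_mx _ _ _ _]mxE (negbTE lj) andbF mulr0.
  under eq_bigr => k _ do rewrite Gam_coord /bil exchange_big mulr_sumr.
  rewrite exchange_big; apply: eq_bigr => m _ /=.
  under eq_bigr => k _ do rewrite mulr_sumr.
  rewrite exchange_big; apply: eq_bigr => i _ /=.
  by rewrite 2!mulr_suml; apply: eq_bigr => k _; ring.
have gsum w v' : gform G x w v' = \sum_j v' 0 j * gform G x w (delta_mx 0 j).
  rewrite [in LHS](row_sum_delta v').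
  elim/big_rec2 : _ => [|j y1 y2 _ <-]; first by rewrite gform0r.
  by rewrite gformDr gformZr.
rewrite [X in X + _]gsum [X in _ + X]gform_sym// [X in _ + X]gsum.
under [X in X + _]eq_bigr => m _ do rewrite low mulr_sumr.
rewrite exchange_big -big_split; apply: eq_bigr => j _ /=.
rewrite low mulr_sumr -big_split; apply: eq_bigr => m _ /=.
rewrite (derive_dirE _ (smooth_on_diff (smooth_gram_entry _ _) Ox)).
rewrite 2!mulr_suml 2!mulr_sumr -big_split; apply: eq_bigr => i _ /=.
by rewrite derive_gram// /GRing.scale/=; ring.
Qed.

(** The fields live on V and the base point moves along [pi]: with [pi = id] these are fields on M,
    with [pi = fst] fields along the bundle projection. *)
Lemma is_derive_gform V (pi : V -> rV) (X Y : V -> rV) (z v : V) dX dY :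
  O (pi z) -> differentiable pi z -> is_derive z v X dX -> is_derive z v Y dY ->
  is_derive z v (fun w => gform G (pi w) (X w) (Y w))
    (gform G (pi z) (dX + Gam (pi z) ('D_v pi z) (X z)) (Y z) +
     gform G (pi z) (X z) (dY + Gam (pi z) ('D_v pi z) (Y z))).
Proof.
move=> Oz dpi HX HY.
have HG i j : is_derive z v (fun w => G (pi w) i j) ('D_('D_v pi z) (fun x => G x i j) (pi z)).
  exact: (is_derive_comp v dpi (smooth_on_diff (smooth_gram_entry i j) Oz)).
under eq_fun do rewrite gformE.
apply: is_derive_eq (is_derive_bil HG HX HY) _.
by rewrite gram_compat_Gam// gformDl gformDr !gformE; ring.
Qed.

Local Notation dGam := (dchristoffel_form G).

Lemma dGamE x p u v : dGam x p u v = 'D_p (fun z => Gam z u v) x.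
Proof. by rewrite unlock. Qed.

Lemma dGam_coord x p u v k : O x ->
  dGam x p u v 0 k = bil (fun i j => 'D_p (fun z => christoffel G z k i j) x) u v.
Proof.
move=> Ox; pose D k := bil (fun i j => 'D_p (fun z => christoffel G z k i j) x) u v.
suff : is_derive x p (fun z => Gam z u v) (\row_k D k).
  by move=> /(@derive_val _ _ _ _ _ _ _) E; rewrite dGamE E mxE.
apply/is_derive_mxP => i {}k; rewrite mxE ord1.
under eq_fun do rewrite Gam_coord.
have H i' j : is_derive x p (fun w => christoffel G w k i' j)
    ('D_p (fun x => christoffel G x k i' j) x).
  exact/derivableP/diff_derivable/smooth_on_diff/Ox/smooth_christoffel.
apply: is_derive_eq (is_derive_bil H (is_derive_cst u x p) (is_derive_cst v x p)) _.
by rewrite bil0l bil0r !addr0.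
Qed.

Lemma is_derive_Gam V (pi : V -> rV) (X Y : V -> rV) (z v : V) dX dY :
  O (pi z) -> differentiable pi z -> is_derive z v X dX -> is_derive z v Y dY ->
  is_derive z v (fun w => Gam (pi w) (X w) (Y w))
    (dGam (pi z) ('D_v pi z) (X z) (Y z) +
     Gam (pi z) dX (Y z) + Gam (pi z) (X z) dY).
Proof.
move=> Oz dpi HX HY; apply/is_derive_mxP => i k; rewrite ord1 {i}.
have HG i j : is_derive z v (fun w => christoffel G (pi w) k i j)
    ('D_('D_v pi z) (fun x => christoffel G x k i j) (pi z)).
  exact: (is_derive_comp v dpi (smooth_on_diff (smooth_christoffel k i j) Oz)).
under eq_fun do rewrite Gam_coord.
apply: is_derive_eq (is_derive_bil HG HX HY) _.
by rewrite [in RHS]mxE [in X in _ = X + _]mxE dGam_coord// !Gam_coord.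
Qed.

Local Notation Rm := (curv G).

Lemma curvE x X Y Z :
  Rm x X Y Z = (dGam x X Y Z + Gam x X (Gam x Y Z)) - (dGam x Y X Z + Gam x Y (Gam x X Z)).
Proof. by rewrite !unlock. Qed.

Lemma curv_anti x X Y Z : Rm x Y X Z = - Rm x X Y Z.
Proof. by rewrite !curvE opprB. Qed.

Lemma dGamDp x p q u v : O x -> dGam x (p + q) u v = dGam x p u v + dGam x q u v.
Proof.
move=> Ox; apply/rowP => k; rewrite [in RHS]mxE !(dGam_coord _ _ _ _ Ox) -bilDc.
apply: eq_bil => i j.
have d := smooth_on_diff (smooth_christoffel k i j) Ox.
exact: (deriveDdir p q d).
Qed.

Lemma dGamZp x c p u v : O x -> dGam x (c *: p) u v = c *: dGam x p u v.
Proof.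
move=> Ox; apply/rowP => k; rewrite [in RHS]mxE !(dGam_coord _ _ _ _ Ox) -bilZc.
apply: eq_bil => i j.
have d := smooth_on_diff (smooth_christoffel k i j) Ox.
exact: (deriveZdir c p d).
Qed.

Lemma dGamDl x p u u' v : O x -> dGam x p (u + u') v = dGam x p u v + dGam x p u' v.
Proof. by move=> Ox; apply/rowP => k; rewrite [in RHS]mxE !dGam_coord// bilDl. Qed.
Lemma dGamDr x p u v v' : O x -> dGam x p u (v + v') = dGam x p u v + dGam x p u v'.
Proof. by move=> Ox; apply/rowP => k; rewrite [in RHS]mxE !dGam_coord// bilDr. Qed.
Lemma dGamZl x p c u v : O x -> dGam x p (c *: u) v = c *: dGam x p u v.
Proof. by move=> Ox; apply/rowP => k; rewrite [in RHS]mxE !dGam_coord// bilZl. Qed.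
Lemma dGamZr x p c u v : O x -> dGam x p u (c *: v) = c *: dGam x p u v.
Proof. by move=> Ox; apply/rowP => k; rewrite [in RHS]mxE !dGam_coord// bilZr. Qed.

Lemma dGamC x p u v : O x -> dGam x p u v = dGam x p v u.
Proof.
move=> Ox; rewrite !dGamE; apply: near_eq_derive.
by apply: filterS (open_nbhs_nbhs (conj oO Ox)) => z Oz; exact: GamC.
Qed.

Lemma curvD1 x X X' Y Z : O x -> Rm x (X + X') Y Z = Rm x X Y Z + Rm x X' Y Z.
Proof.
move=> Ox; rewrite !curvE dGamDp// dGamDl// !GamDl GamDr.
by row_ring.
Qed.

Lemma curvZ1 x c X Y Z : O x -> Rm x (c *: X) Y Z = c *: Rm x X Y Z.
Proof.
move=> Ox; rewrite !curvE dGamZp// dGamZl// !GamZl GamZr.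
by rewrite scalerBr !scalerDr.
Qed.

Lemma curvD2 x X Y Y' Z : O x -> Rm x X (Y + Y') Z = Rm x X Y Z + Rm x X Y' Z.
Proof. by move=> Ox; rewrite curv_anti curvD1// opprD -!curv_anti. Qed.

Lemma curvZ2 x c X Y Z : O x -> Rm x X (c *: Y) Z = c *: Rm x X Y Z.
Proof. by move=> Ox; rewrite curv_anti curvZ1// -scalerN -curv_anti. Qed.

Lemma curvD3 x X Y Z Z' : O x -> Rm x X Y (Z + Z') = Rm x X Y Z + Rm x X Y Z'.
Proof.
move=> Ox; rewrite !curvE !dGamDr// !GamDr.
by row_ring.
Qed.

Lemma curvZ3 x c X Y Z : O x -> Rm x X Y (c *: Z) = c *: Rm x X Y Z.
Proof.
move=> Ox; rewrite !curvE !dGamZr// !GamZr.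
by rewrite scalerBr !scalerDr.
Qed.

(** For constant components there are no brackets, and the symmetry of the Christoffel form makes
    the twelve terms cancel in pairs. *)
Lemma curv_bianchi x X Y Z : O x -> Rm x X Y Z + Rm x Y Z X + Rm x Z X Y = 0.
Proof.
move=> Ox; rewrite !curvE.
rewrite (dGamC X Z Y Ox) (dGamC Y X Z Ox) (dGamC Z X Y Ox).
rewrite (GamC Z Y Ox) (GamC X Z Ox) (GamC Y X Ox).
by row_ring.
Qed.

(** For constant Z the second derivatives of g(Z, Z) along X and Y commute, and twice the left side
    is the difference of the two orders of differentiation. *)
Lemma gform_curv_self x X Y Z : O x -> gform G x (Rm x X Y Z) Z = 0.
Proof.
move=> Ox.
have oO' := open_nbhs_nbhs (conj oO Ox).
have sg : smooth_on O (fun z => gform G z Z Z).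
  under eq_fun do rewrite gformE; rewrite /bil.
  do 2 (apply: smooth_on_sum => // ? _).
  do 2 (apply: smooth_onM => //; last exact: smooth_on_cst).
  exact: smooth_gram_entry.
have d1 p z : O z -> 'D_p (fun z => gform G z Z Z) z = 2 * gform G z (Gam z p Z) Z.
  move=> Oz; have := @is_derive_gform _ id (fun=> Z) (fun=> Z) z p 0 0 Oz.
  move=> /(_ (@ex_diff _ _ _ _ _ _ _ (is_diff_id _)) (is_derive_cst _ _ _) (is_derive_cst _ _ _)) H.
  rewrite (@derive_val _ _ _ _ _ _ _ H) derive_id !add0r (gform_sym Z _ Oz); by ring.
have d2 p q : 'D_p ('D_q (fun z => gform G z Z Z)) x =
    2 * (gform G x (dGam x p q Z + Gam x p (Gam x q Z)) Z +
         gform G x (Gam x q Z) (Gam x p Z)).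
  rewrite (@near_eq_derive _ _ _ _ (fun z => 2 * gform G z (Gam z q Z) Z)); last first.
    by apply: filterS oO' => z Oz; exact: d1.
  have H1 := @is_derive_Gam _ id (fun=> q) (fun=> Z) x p 0 0 Ox
    (@ex_diff _ _ _ _ _ _ _ (is_diff_id _)) (is_derive_cst _ _ _) (is_derive_cst _ _ _).
  have H2 := @is_derive_gform _ id _ (fun=> Z) x p _ 0 Ox
    (@ex_diff _ _ _ _ _ _ _ (is_diff_id _)) H1 (is_derive_cst _ _ _).
  have H3 := is_deriveME (is_derive_cst (2 : R) _ _) H2.
  rewrite (@derive_val _ _ _ _ _ _ _ H3) derive_id mul0r add0r add0r Gam0l Gam0r !addr0.
  by [].
have := derive_sym X Y oO Ox sg; rewrite !d2 => /mulfI; rewrite pnatr_eq0 => /(_ isT).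
rewrite (gform_sym (Gam x X Z) _ Ox) => /addIr E.
by rewrite curvE gformDl gformNl E subrr.
Qed.

Lemma gform_curv_anti x X Y Z W : O x ->
  gform G x (Rm x X Y Z) W = - gform G x (Rm x X Y W) Z.
Proof.
move=> Ox; have := gform_curv_self X Y (Z + W) Ox.
rewrite curvD3// !gformDl !gformDr.
rewrite (gform_curv_self X Y Z Ox) (gform_curv_self X Y W Ox) add0r addr0 => /eqP.
by rewrite addr_eq0 => /eqP.
Qed.

End LocalGeometry.

(** * Constant curvature *)

Section AlgebraicCurvature.
Context {R : realType} {V : lmodType R}.
Variable S : V -> V -> V -> V -> R.
Hypothesis S1D : forall X X' Y Z W, S (X + X') Y Z W = S X Y Z W + S X' Y Z W.
Hypothesis S2D : forall X Y Y' Z W, S X (Y + Y') Z W = S X Y Z W + S X Y' Z W.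
Hypothesis S3D : forall X Y Z Z' W, S X Y (Z + Z') W = S X Y Z W + S X Y Z' W.
Hypothesis S4D : forall X Y Z W W', S X Y Z (W + W') = S X Y Z W + S X Y Z W'.
Hypothesis S12 : forall X Y Z W, S Y X Z W = - S X Y Z W.
Hypothesis S34 : forall X Y Z W, S X Y W Z = - S X Y Z W.
Hypothesis S_bianchi : forall X Y Z W, S X Y Z W + S Y Z X W + S Z X Y W = 0.

(** Four cyclic instances of the Bianchi identity, reduced by the two antisymmetries to common
    terms, combine linearly to the claim. *)
Lemma curvature_pair_sym X Y Z W : S X Y Z W = S Z W X Y.
Proof.
have := S_bianchi X Y Z W; have := S_bianchi Y Z W X.
have := S_bianchi Z W X Y; have := S_bianchi W X Y Z.
rewrite (S12 X Z Y W) (S34 Y Z X W) (S34 Z W X Y) (S12 Y W Z X) (S34 Y W X Z) !opprK.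
by rewrite (S12 X W Z Y) (S34 X W Y Z) (S34 X Z Y W) (S12 X W Y Z) (S34 X Y Z W) !opprK; lra.
Qed.

(** Polarising in X and then in Y makes S antisymmetric in its two middle arguments as well; the
    Bianchi identity then reads 3 S = 0. *)
Lemma curvature_eq0 : (forall X Y, S X Y Y X = 0) -> forall X Y Z W, S X Y Z W = 0.
Proof.
move=> S0.
have S1 X Y W : S X Y Y W = 0.
  have := S0 (X + W) Y; rewrite S1D !S4D !S0 add0r addr0.
  by rewrite (curvature_pair_sym W Y Y X) (S12 X Y) (S34 X Y Y W); lra.
move=> X Y Z W.
have H A B C : S A B C W = - S A C B W.
  by have := S1 A (B + C) W; rewrite S2D !S3D !S1; lra.
have := S_bianchi X Y Z W.
by rewrite (H Y Z X) (S12 X Y) (S12 X Z) (H X Z Y); lra.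
Qed.

End AlgebraicCurvature.

Section ConstantCurvature.
Context {R : realType} {n : nat}.
Local Notation rV := 'rV[R]_n.
Variables (O : set rV) (G : rV -> 'M[R]_n).
Hypothesis lm : local_metric O G.

Let posG := lm_pos lm.
Let D1 := curvD1 lm.
Let D2 := curvD2 lm.
Let D3 := curvD3 lm.
Let Z1 := curvZ1 lm.
Let Z2 := curvZ2 lm.
Let anti := gform_curv_anti lm.
Let bianchi := curv_bianchi lm.
Let gC := gform_sym lm.

Lemma gram_det_gt0 x X Y : O x -> row_free (col_mx X Y) ->
  0 < gform G x X X * gform G x Y Y - gform G x X Y ^+ 2.
Proof.
move=> Ox free.
have Y0 : Y != 0.
  apply: contraTneq free => ->; apply/negP => /row_free_inj H.
  have := H _ (row_mx 0 1 : 'rV_(1+1)) 0; rewrite mul_row_col mulmx0 mul0mx addr0 mul0mx.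
  by move=> /(_ erefl) /rowP /(_ (rshift 1 0)); rewrite row_mxEr !mxE eqxx => /eqP;
    rewrite oner_eq0.
have YY := posG Ox Y0.
(* The square length of this vector is g(Y, Y) times the Gram determinant. *)
pose v := gform G x Y Y *: X - gform G x X Y *: Y.
have v0 : v != 0.
  apply/negP => /eqP v0; move/row_free_inj : free => H.
  have := H _ (row_mx (gform G x Y Y)%:M (- gform G x X Y)%:M : 'rV_(1+1)) 0.
  rewrite mul_row_col !mul_scalar_mx scaleNr mul0mx => /(_ v0) /rowP /(_ (lshift 1 0)).
  by rewrite row_mxEl !mxE eqxx mulr1n => E; rewrite E ltxx in YY.
have := posG Ox v0; rewrite /v gformDl !gformDr !gformZl !gformZr.
rewrite !gformNl !gformNr !gformZl !gformZr.
rewrite (gC Y X Ox) => H.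
rewrite -(pmulr_rgt0 _ YY); move: H.
by congr (_ < _); ring.
Qed.

(** The difference between the curvature and the model tensor of constant curvature c has all the
    curvature symmetries and vanishes on (X, Y, Y, X), hence is zero. *)
Lemma sectional_constant_curv x c : O x ->
  (forall X Y, row_free (col_mx X Y) -> sectional G x X Y = c) ->
  forall X Y Z, curv G x X Y Z = c *: (gform G x Y Z *: X - gform G x X Z *: Y).
Proof.
move=> Ox Hc X Y Z; apply: (gform_inj lm Ox) => W.
rewrite gformZl gformDl gformNl !gformZl.
pose S X Y Z W := gform G x (curv G x X Y Z) W -
  c * (gform G x Y Z * gform G x X W - gform G x X Z * gform G x Y W).
suff : S X Y Z W = 0 by rewrite /S => /eqP; rewrite subr_eq0 => /eqP.
have S0 A : gform G x (curv G x A A A) A = 0.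
  by have := anti A A A A Ox; lra.
apply: (@curvature_eq0 R rV); rewrite /S.
- by move=> *; rewrite D1// !gformDl; ring.
- by move=> *; rewrite D2// !gformDl; ring.
- by move=> *; rewrite D3// !gformDl !gformDr; ring.
- by move=> *; rewrite !gformDr; ring.
- by move=> *; rewrite curv_anti gformNl; ring.
- by move=> A B C D; rewrite (anti A B D C Ox) ; ring.
- move=> A B C D; rewrite (gC B A Ox) (gC C A Ox) (gC C B Ox).
  have := bianchi A B C Ox => /(congr1 (fun v => gform G x v D)).
  rewrite !gformDl gform0l; lra.
move=> {X Z W} X {}Y.
have [->|Y0] := eqVneq Y 0.
  by rewrite -(scale0r (0 : rV)) Z2// !gformZl !gformZr; ring.
(* The hypothesis covers independent pairs only; on proportional ones both tensors vanish by
   antisymmetry. *)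
have [[l ->]|nl] := pselect (exists l, X = l *: Y).
  rewrite Z1// !gformZl !gformZr.
  have := anti Y Y Y Y Ox; set t := gform G x (curv G x Y Y Y) Y => H.
  have -> : t = 0 by lra.
  by ring.
have free : row_free (col_mx X Y).
  apply: inj_row_free => u; rewrite -[u]hsubmxK mul_row_col.
  rewrite [lsubmx u]mx11_scalar [rsubmx u]mx11_scalar !mul_scalar_mx.
  move: (lsubmx u 0 0) (rsubmx u 0 0) => s t E.
  have s0 : s = 0.
    apply/eqP/negP => /negP s0; apply: nl; exists (- s^-1 * t).
    move: E => /eqP; rewrite addr_eq0 => /eqP E.
    by rewrite -[X](scalerK s0) E scalerN -scaleNr scalerA mulNr.
  move: E; rewrite s0 scale0r add0r => /eqP; rewrite scaler_eq0 (negbTE Y0) orbF => /eqP->.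
  by rewrite !raddf0 row_mx0.
have := Hc X Y free; have d0 := gram_det_gt0 Ox free.
rewrite /sectional => /(canRL (divfK (lt0r_neq0 d0))) E.
have -> : gform G x (curv G x X Y Y) X = gform G x (riemann G x X Y Y) X by rewrite unlock.
by rewrite E (gC Y X Ox); ring.
Qed.

Lemma curv_constant_sectional x c : O x ->
  (forall X y, gform G x y y = 1 ->
    forall P, gform G x P y = 0 -> gform G x (curv G x X y y) P = c * gform G x X P) ->
  forall X Y, row_free (col_mx X Y) -> sectional G x X Y = c.
Proof.
move=> Ox H X Y free; have d0 := gram_det_gt0 Ox free.
rewrite /sectional; apply/(canLR (mulfK (lt0r_neq0 d0))).
have -> : gform G x (riemann G x X Y Y) X = gform G x (curv G x X Y Y) X by rewrite unlock.
have YY : 0 < gform G x Y Y.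
  apply: posG => //; apply/negP => /eqP Y0; move: d0.
  by rewrite Y0 !gform0l !gform0r mulr0 expr0n subrr ltxx.
have [s s0 ss] : exists2 s, 0 < s & s * s = gform G x Y Y.
  exists (Num.sqrt (gform G x Y Y)); first by rewrite sqrtr_gt0.
  by rewrite -expr2 sqr_sqrtr// ltW.
have [y Yy] : exists y, Y = s *: y.
  by exists (s^-1 *: Y); rewrite scalerA mulfV ?gt_eqF// scale1r.
have yy : gform G x y y = 1.
  have s00 : s != 0 by rewrite gt_eqF.
  apply: (mulfI (mulf_neq0 s00 s00)); rewrite mulr1 {2}ss Yy gformZl gformZr.
  by ring.
have self : gform G x (curv G x X y y) y = 0.
  exact: gform_curv_self lm _ _ _ _ Ox.
(* R(X, y)y is orthogonal to y, so pairing it with X or with this orthogonal component of X gives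
   the same value. *)
pose P := X - gform G x X y *: y.
have Py : gform G x P y = 0 by rewrite gformDl gformNl gformZl yy; ring.
have := H X y yy P Py.
rewrite {1}/P gformDr gformNr gformZr self mulr0 subr0 => E.
rewrite Yy Z2// (curvZ3 lm)// !gformZl !gformZr E.
rewrite /P gformDr gformNr !gformZr yy; by ring.
Qed.

End ConstantCurvature.

(** * Geometry of the unit bundle *)

(* The pullback to the bundle of the Levi-Civita connection of M. *)
HB.lock Definition hcov (R : realType) (n : nat) (G : 'rV[R]_n -> 'M[R]_n)
    (v : bundle R n) (X : bundle R n -> 'rV[R]_n) (z : bundle R n) : 'rV[R]_n :=
  'D_v X z + christoffel_form G z.1 v.1 (X z).

Section BundleCalculus.
Context {R : realType} {n : nat}.
Local Notation rV := 'rV[R]_n.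
Local Notation E := (bundle R n).
Variables (O : set rV) (G : rV -> 'M[R]_n).
Hypothesis lm : local_metric O G.
Local Notation g z := (gform G z.1).
Local Notation Gam z := (christoffel_form G z.1).
Local Notation slit := (@slit_bundle R n O).
Local Notation unit := (unit_bundle O G).

Lemma open_slit : open slit.
Proof.
apply: (@openI _ (fst @^-1` O) (snd @^-1` [set v : rV | v != 0])).
  by apply: open_comp; [move=> z _; exact: cvg_fst|exact: lm_open lm].
apply: open_comp; first by move=> z _; exact: cvg_snd.
rewrite (_ : [set v | _] = ~` [set 0]); last by apply/seteqP; split=> v /eqP.
by apply: closed_openC; apply: accessible_closed_set1;
  apply: hausdorff_accessible; exact: norm_hausdorff.
Qed.
Let os := open_slit.

Lemma unit_slit z : unit z -> slit z.
Proof.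
move=> [Oz zz]; split=> //; apply/eqP => z0; move: zz.
by rewrite z0 gform0l => /esym/eqP; rewrite oner_eq0.
Qed.

Lemma slit_nbhs z : slit z -> nbhs z slit.
Proof. by move=> sz; exact: open_nbhs_nbhs (conj os sz). Qed.

Lemma smooth_base : smooth_on slit (fun z : E => z.1).
Proof. by apply: (smooth_on_fst os); exact: smooth_on_id. Qed.

Lemma smooth_fiber : smooth_on slit (fun z : E => z.2).
Proof. by apply: (smooth_on_snd os); exact: smooth_on_id. Qed.

Lemma smooth_on_bil (A : set E) (B : E -> 'I_n -> 'I_n -> R) (X Y : E -> rV) : open A ->
  (forall i j, smooth_on A (fun z => B z i j)) -> smooth_on A X -> smooth_on A Y ->
  smooth_on A (fun z => bil (B z) (X z) (Y z)).
Proof.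
move=> oA sB sX sY; do 2 (apply: smooth_on_sum => // ? _).
apply: smooth_onM => //; last exact: smooth_on_coord.
by apply: smooth_onM => //; exact: smooth_on_coord.
Qed.

Lemma smooth_gform (X Y : E -> rV) : smooth_on slit X -> smooth_on slit Y ->
  smooth_on slit (fun z => g z (X z) (Y z)).
Proof.
move=> sX sY; under eq_fun do rewrite gformE.
apply: smooth_on_bil => // i j.
apply: (smooth_on_comp (has_coords_mx _ _) os (B := O) (g := fun x => G x i j) _ _ smooth_base).
  by move=> z [].
exact: smooth_gram_entry lm i j.
Qed.

Lemma smooth_Gam (X Y : E -> rV) : smooth_on slit X -> smooth_on slit Y ->
  smooth_on slit (fun z => Gam z (X z) (Y z)).
Proof.
move=> sX sY; apply: smooth_on_mx => // i k; rewrite ord1.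
under eq_fun do rewrite Gam_coord.
apply: smooth_on_bil => // {}i j.
apply: (smooth_on_comp (has_coords_mx _ _) os (B := O) (g := fun x => christoffel G x k i j)
  _ _ smooth_base).
  by move=> z [].
exact: smooth_christoffel lm k i j.
Qed.

Lemma vpartD z v w : vpart G z (v + w) = vpart G z v + vpart G z w.
Proof. by rewrite /vpart /= GamDl addrACA. Qed.
Lemma vpartZ z c v : vpart G z (c *: v) = c *: vpart G z v.
Proof. by rewrite /vpart /= GamZl scalerDr. Qed.
Lemma vpartN z v : vpart G z (- v) = - vpart G z v.
Proof. by rewrite -scaleN1r vpartZ scaleN1r. Qed.
Lemma vpart_hlift z X : vpart G z (hlift G z X) = 0.
Proof. by rewrite /vpart /= addNr. Qed.
Lemma vpart_vlift z X : vpart G z (vlift X) = X.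
Proof. by rewrite /vpart /= Gam0l addr0. Qed.
Lemma bundle_split z v : v = hlift G z v.1 + vlift (vpart G z v).
Proof.
case: v => p q; congr pair; rewrite /= ?addr0//.
by rewrite /vpart/= [q + _]addrC addKr.
Qed.
Lemma bundle_eq z v w : v.1 = w.1 -> vpart G z v = vpart G z w -> v = w.
Proof. by move=> e1 e2; rewrite (bundle_split z v) (bundle_split z w) e1 e2. Qed.

Lemma smooth_vpart (U : E -> E) : smooth_on slit U -> smooth_on slit (fun z => vpart G z (U z)).
Proof.
move=> sU; apply: smooth_onD => //; first exact: smooth_on_snd.
by apply: smooth_Gam; [exact: smooth_on_fst|exact: smooth_fiber].
Qed.

Lemma smooth_hlift (X : E -> rV) : smooth_on slit X -> smooth_on slit (fun z => hlift G z (X z)).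
Proof.
move=> sX; apply: smooth_on_pair => //; apply: smooth_onN => //.
by apply: smooth_Gam => //; exact: smooth_fiber.
Qed.

Lemma smooth_vlift (X : E -> rV) : smooth_on slit X -> smooth_on slit (fun z => vlift (X z)).
Proof. by move=> sX; apply: smooth_on_pair => //; exact: smooth_on_cst. Qed.

Lemma diff_fst (z : E) : differentiable (fst : E -> rV) z.
Proof.
have := @smooth_on_diff _ _ _ _ _ z (@smooth_on_fst _ _ _ _ _ id openT (smooth_on_id openT)).
exact.
Qed.

Lemma diff_snd (z : E) : differentiable (snd : E -> rV) z.
Proof.
have := @smooth_on_diff _ _ _ _ _ z (@smooth_on_snd _ _ _ _ _ id openT (smooth_on_id openT)).
exact.
Qed.

Lemma is_derive_linear (V W Z : normedModType R) (L : W -> Z) (f : V -> W) (z v : V) df :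
  linear L -> continuous L -> is_derive z v f df -> is_derive z v (L \o f) (L df).
Proof.
move=> lL cL [dvf <-].
have H : (fun h => h^-1 *: ((L \o f) (h *: v + z) - (L \o f) z)) @ 0^' --> L ('D_v f z).
  rewrite [X in X @ _](_ : _ = L \o (fun h => h^-1 *: (f (h *: v + z) - f z))).
    have D : (fun h => h^-1 *: (f (h *: v + z) - f z)) @ 0^' --> 'D_v f z by exact: dvf.
    exact: (continuous_cvg _ (cL ('D_v f z)) D).
  apply/funext => h /=.
  have L0 : L 0 = 0 by have := lL (-1) 0 0; rewrite scaler0 addr0 scaleN1r addNr.
  have LZ c w : L (c *: w) = c *: L w by have := lL c w 0; rewrite L0 !addr0.
  have LB a b : L (a - b) = L a - L b.
    by have := lL (-1) b a; rewrite !scaleN1r [- b + _]addrC [- L b + _]addrC.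
  by rewrite LZ LB.
split; first by apply/cvg_ex; eexists; exact: H.
exact: cvg_lim H.
Qed.

Lemma is_derive_fst (U : E -> E) (z v : E) dU : is_derive z v U dU ->
  is_derive z v (fun w => (U w).1) dU.1.
Proof. by apply: (is_derive_linear (L := fst)) => // x; exact: cvg_fst. Qed.

Lemma is_derive_snd (U : E -> E) (z v : E) dU : is_derive z v U dU ->
  is_derive z v (fun w => (U w).2) dU.2.
Proof. by apply: (is_derive_linear (L := snd)) => // x; exact: cvg_snd. Qed.

Lemma is_derive_pair (X Y : E -> rV) (z v : E) dX dY :
  is_derive z v X dX -> is_derive z v Y dY ->
  is_derive z v (fun w => (X w, Y w) : E) (dX, dY).
Proof.
move=> HX HY.
have H1 : is_derive z v (fun w => (X w, 0) : E) (dX, 0).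
  exact: (is_derive_linear (@pairl_linear _ rV rV) (@pairl_continuous _ rV rV) HX).
have H2 : is_derive z v (fun w => (0, Y w) : E) (0, dY).
  exact: (is_derive_linear (@pairr_linear _ rV rV) (@pairr_continuous _ rV rV) HY).
have := is_deriveD H1 H2.
rewrite (_ : (dX, 0) + (0, dY) = (dX, dY)); last by congr pair => /=; rewrite ?addr0 ?add0r.
by rewrite [X in is_derive _ _ X](_ : _ = (fun w => (X w, Y w) : E))//;
  apply/funext => w; congr pair => /=; rewrite ?addr0 ?add0r.
Qed.

Lemma is_derive_scale (f : E -> R) (X : E -> rV) (z v : E) df dX :
  differentiable f z -> differentiable X z ->
  is_derive z v f df -> is_derive z v X dX ->
  is_derive z v (fun w => f w *: X w) (f z *: dX + df *: X z).
Proof.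
move=> d1 d2 [_ <-] [_ <-]; have d := is_diff_scale d1 d2.
apply: is_derive_eq (is_derive_diff v (@ex_diff _ _ _ _ _ _ _ d)) _.
by rewrite (@diff_val _ _ _ _ _ _ _ d) !deriveE.
Qed.

Lemma derive_fst (z v : E) : 'D_v (fst : E -> rV) z = v.1.
Proof. exact: (@derive_val _ _ _ _ _ _ _ (is_derive_fst (is_derive_id z v))). Qed.

Lemma derive_snd (z v : E) : 'D_v (snd : E -> rV) z = v.2.
Proof. exact: (@derive_val _ _ _ _ _ _ _ (is_derive_snd (is_derive_id z v))). Qed.

Lemma hcovE v X z : hcov G v X z = 'D_v X z + Gam z v.1 (X z).
Proof. by rewrite unlock. Qed.

Lemma hcov_fiber v z : hcov G v snd z = vpart G z v.
Proof. by rewrite hcovE derive_snd. Qed.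

Lemma is_derive_gform_cov (X Y : E -> rV) (z v : E) : O z.1 ->
  differentiable X z -> differentiable Y z ->
  is_derive z v (fun w => g w (X w) (Y w))
    (g z (hcov G v X z) (Y z) + g z (X z) (hcov G v Y z)).
Proof.
move=> Oz dX dY.
have := is_derive_gform lm Oz (diff_fst z)
  (derivableP (@diff_derivable _ _ _ _ _ v dX)) (derivableP (@diff_derivable _ _ _ _ _ v dY)).
by rewrite derive_fst !hcovE.
Qed.

Lemma derive_norm (z v : E) : O z.1 ->
  'D_v (fun w : E => g w w.2 w.2) z = 2 * g z (vpart G z v) z.2.
Proof.
move=> Oz; have H := is_derive_gform_cov v Oz (diff_snd z) (diff_snd z).
rewrite (@derive_val _ _ _ _ _ _ _ H) hcov_fiber (gform_sym lm z.2 _ Oz); ring.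
Qed.

Definition tangent (z v : E) : Prop := g z (vpart G z v) z.2 = 0.

Lemma bundle_fieldP (U : E -> E) : bundle_field O G U <->
  smooth_on slit U /\ forall z, unit z -> tangent z (U z).
Proof.
split=> -[sU tU]; split=> // z uz; have := tU z uz; rewrite derive_norm; try exact: uz.1.
  by move=> /eqP; rewrite mulf_eq0 pnatr_eq0/= => /eqP.
by rewrite /tangent => ->; rewrite mulr0.
Qed.

(* A function vanishing on the unit bundle vanishes after composition with the
   retraction y |-> y / |y|, whose differential fixes the tangent vectors. *)
Lemma derive_unit_eq0 (f : E -> R) z v : unit z -> tangent z v ->
  differentiable f z -> (forall w, unit w -> f w = 0) -> 'D_v f z = 0.
Proof.
move=> uz tv df f0; have sz := unit_slit uz.
pose h (x : R) := (Num.sqrt x)^-1.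
pose q (w : E) : R := g w w.2 w.2.
pose rho := h \o q.
pose r (w : E) : E := (w.1, rho w *: w.2).
have srho : smooth_on slit rho.
  have pos w : slit w -> 0 < g w w.2 w.2 by move=> [Ow w0]; exact: (lm_pos lm).
  apply: smooth_onV => //; first by move=> w /pos; rewrite -sqrtr_gt0 => /gt_eqF ->.
  by apply: smooth_on_sqrt => //; apply: smooth_gform; exact: smooth_fiber.
have sr : smooth_on slit r.
  apply: smooth_on_pair => //; first exact: smooth_base.
  by apply: smooth_onZ => //; exact: smooth_fiber.
have rz : r z = z.
  by rewrite /r /rho /h /q /= uz.2 sqrtr1 invr1 scale1r; case: (z).
have dr := smooth_on_diff sr sz.
have fr w : slit w -> f (r w) = 0.
  move=> [Ow w0]; apply: f0; split=> //=; rewrite gformZl gformZr /rho.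
  have p := lm_pos lm Ow w0.
  by rewrite mulrA -invfM -expr2 sqr_sqrtr ?ltW// mulVf// gt_eqF.
have Dr : 'D_v r z = v.
  have qz : q z = 1 by rewrite /q uz.2.
  have dh : differentiable h (q z).
    have oR : open [set x : R | 0 < x] by exact: open_gt.
    have sh : smooth_on [set x : R | 0 < x] h.
      apply: smooth_onV => //; first by move=> x /=; rewrite -sqrtr_gt0 => /gt_eqF ->.
      by apply: smooth_on_sqrt => //; exact: smooth_on_id.
    by apply: (smooth_on_diff sh); rewrite qz /= ltr01.
  have sq : smooth_on slit q by apply: smooth_gform; exact: smooth_fiber.
  have dq := smooth_on_diff sq sz.
  have Drho : is_derive z v rho 0.
    apply: is_derive_eq (is_derive_comp v dq dh) _.
    by rewrite [X in 'D_X h _]derive_norm ?tv ?mulr0 ?derive0//; exact: uz.1.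
  have H1 := is_derive_fst (is_derive_id z v).
  have H2 := is_derive_snd (is_derive_id z v).
  have H3 := is_derive_scale (smooth_on_diff srho sz) (diff_snd z) Drho H2.
  rewrite (@derive_val _ _ _ _ _ _ _ (is_derive_pair H1 H3)) scale0r addr0.
  by rewrite /rho /h /= qz sqrtr1 invr1 scale1r; case: (v).
have df' : differentiable f (r z) by rewrite rz.
have := derive_comp v dr df'; rewrite Dr rz => <-.
rewrite (@near_eq_derive _ _ _ _ (fun=> 0)) ?derive_cst//.
by apply: filterS (slit_nbhs sz) => w; exact: fr.
Qed.

End BundleCalculus.

(** * The induced structure in horizontal and vertical parts *)

Section InducedStructure.
Context {R : realType} {n : nat}.
Local Notation rV := 'rV[R]_n.
Local Notation E := (bundle R n).
Variables (O : set rV) (G : rV -> 'M[R]_n).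
Hypothesis lm : local_metric O G.
Variables (a b : R -> R) (eps : R).
Hypothesis a_smooth : smooth_half_line a.
Hypothesis b_smooth : smooth_half_line b.
Hypothesis a_gt0 : forall t : R, 0 <= t -> 0 < a t.
Hypothesis b_ge0 : forall t : R, 0 <= t -> 0 <= b t.
Hypothesis eps2 : eps * eps = 1.
Local Notation g z := (gform G z.1).
Local Notation Gam z := (christoffel_form G z.1).
Local Notation slit := (@slit_bundle R n O).
Local Notation unit := (unit_bundle O G).
Local Notation vp := (vpart G).
Let os := open_slit lm.
Let gC := gform_sym lm.

Definition sqnorm (z : E) : R := g z z.2 z.2.
Definition sqrt_a (z : E) : R := Num.sqrt (a (energy G z)).
Definition sqrt_ab (z : E) : R :=
  Num.sqrt (a (energy G z) + 2 * b (energy G z) * energy G z).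
(** The inverse length of the vertical lift of u: g_A(u^V, u^V) = (a + 2bt) g(u, u), because 2t =
    g(u, u). *)
Definition normal_coeff z := (sqrt_ab z * Num.sqrt (sqnorm z))^-1.
Local Notation q := sqnorm.
Local Notation sa := sqrt_a.
Local Notation sab := sqrt_ab.
Local Notation k := normal_coeff.

Lemma sqnorm_gt0 z : slit z -> 0 < q z.
Proof. by move=> [Oz z0]; exact: (lm_pos lm). Qed.

Lemma energyE z : energy G z = 2^-1 * q z. Proof. by []. Qed.

Lemma energy_ge0 z : slit z -> 0 <= energy G z.
Proof. by move=> /sqnorm_gt0 q0; rewrite energyE mulr_ge0// ltW. Qed.

Lemma energy_unit z : unit z -> energy G z = 2^-1.
Proof. by move=> [_ uz]; rewrite /energy uz mulr1. Qed.

Lemma sqrt_a_gt0 z : slit z -> 0 < sa z.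
Proof. by move=> /energy_ge0 t0; rewrite sqrtr_gt0 a_gt0. Qed.

Lemma sqrt_ab_arg_gt0 z : slit z -> 0 < a (energy G z) + 2 * b (energy G z) * energy G z.
Proof.
move=> /energy_ge0 t0; apply: ltr_wpDr; last exact: a_gt0.
by rewrite mulr_ge0// mulr_ge0// b_ge0.
Qed.

Lemma sqrt_ab_gt0 z : slit z -> 0 < sab z.
Proof. by move=> /sqrt_ab_arg_gt0; rewrite sqrtr_gt0. Qed.

Lemma JA_h z v : (JA G a b eps z v).1 =
  - (sa z *: vp z v) + ((2 * energy G z)^-1 * (sa z + eps * sab z) * g z (vp z v) z.2) *: z.2.
Proof. by rewrite /= add0r. Qed.

Lemma JA_v z v : vp z (JA G a b eps z v) =
  (sa z)^-1 *: v.1 - ((2 * energy G z)^-1 * ((sa z)^-1 + eps / sab z) * g z v.1 z.2) *: z.2.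
Proof. by rewrite /JA vpartD vpart_vlift vpart_hlift addr0. Qed.

Lemma unit_normalE z : slit z -> unit_normal G a b z = k z *: vlift z.2.
Proof.
move=> sz; rewrite /unit_normal; congr (_^-1 *: _).
rewrite /sqrt_ab -sqrtrM ?ltW ?sqrt_ab_arg_gt0//; congr (Num.sqrt _).
rewrite /gA vpart_vlift /hpart /= gform0l add0r energyE -/(q z).
by field.
Qed.

Lemma normal_h z : (k z *: vlift z.2 : E).1 = 0.
Proof. by rewrite /= scaler0. Qed.

Lemma normal_v z : vp z (k z *: vlift z.2) = k z *: z.2.
Proof. by rewrite vpartZ vpart_vlift. Qed.

Let twice_energy z : 2 * energy G z = q z.
Proof. by rewrite energyE mulrA mulfV// mul1r. Qed.

Let sqrt_q z : slit z -> exists2 r, 0 < r & Num.sqrt (q z) = r /\ q z = r * r.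
Proof.
move=> sz; exists (Num.sqrt (q z)); first by rewrite sqrtr_gt0 sqnorm_gt0.
by split=> //; rewrite -expr2 sqr_sqrtr// ltW// sqnorm_gt0.
Qed.

(** On the vertical lift of u the two sqrt(a) terms of [JA] cancel. The remaining eps sqrt(a + 2bt)
    meets its inverse in the normal, and the rescaling supplies a second eps, so b and eps
    disappear. *)
Lemma xiA_h z : slit z ->
  (xiA G a b eps z).1 = (2 * Num.sqrt (a 2^-1) * (Num.sqrt (q z))^-1) *: z.2.
Proof.
move=> sz; rewrite /xiA /xi_ind unit_normalE//.
transitivity ((- (2 * eps * Num.sqrt (a 2^-1))) *: - (JA G a b eps z (k z *: vlift z.2)).1) => //.
rewrite JA_h normal_v gformZl -/(q z) twice_energy /k.
have [r r0 [qr qrr]] := sqrt_q sz.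
have s0 := sqrt_a_gt0 sz; have sb0 := sqrt_ab_gt0 sz.
rewrite opprD opprK scalerBr !scalerA -scalerBl; congr (_ *: _); rewrite qr qrr.
transitivity ((eps * eps) * (2 * Num.sqrt (a 2^-1) / r)); last by rewrite eps2 mul1r.
by field; rewrite !gt_eqF.
Qed.

Lemma xiA_v z : slit z -> vp z (xiA G a b eps z) = 0.
Proof.
move=> sz; rewrite /xiA /xi_ind unit_normalE// vpartZ vpartN JA_v normal_h.
by rewrite scaler0 gform0l mulr0 scale0r subrr oppr0 scaler0.
Qed.

Lemma etaE z v : slit z -> eta_ind G a b eps z v = - eps / Num.sqrt (q z) * g z v.1 z.2.
Proof.
move=> sz; rewrite /eta_ind unit_normalE// /gA /hpart normal_h gform0r add0r normal_v JA_v.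
have [r r0 [qr qrr]] := sqrt_q sz.
have s0 := sqrt_a_gt0 sz; have sb0 := sqrt_ab_gt0 sz.
rewrite !gformDl !gformNl !gformZl !gformZr -/(q z) twice_energy /normal_coeff qr qrr.
(* Expressing a through the square of the second root turns the goal into a rational identity. *)
have sbb : sab z * sab z = a (energy G z) + b (energy G z) * (r * r).
  rewrite -expr2 sqr_sqrtr ?ltW ?sqrt_ab_arg_gt0// energyE qrr; by field.
have -> : a (energy G z) = sab z * sab z - b (energy G z) * (r * r) by rewrite sbb; ring.
by field; rewrite !gt_eqF.
Qed.

Lemma phiA_h z v : slit z -> (phiA G a b eps z v).1 =
  - (sa z *: vp z v) + ((q z)^-1 * (sa z + eps * sab z) * g z (vp z v) z.2) *: z.2.
Proof.
move=> sz; rewrite /phiA /phi_ind unit_normalE// [LHS]/=.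
by rewrite !scaler0 subr0 add0r -/(sa z) -/(sab z) twice_energy.
Qed.

(** Subtracting the normal part cancels the eps term of [JA]; what remains is the component of the
    horizontal part orthogonal to u, divided by sqrt(a). *)
Lemma phiA_v z v : slit z -> vp z (phiA G a b eps z v) =
  (sa z)^-1 *: (v.1 - ((q z)^-1 * g z v.1 z.2) *: z.2).
Proof.
move=> sz; rewrite /phiA /phi_ind unit_normalE// vpartD vpartN vpartZ normal_v JA_v etaE//.
have [r r0 [qr qrr]] := sqrt_q sz.
have s0 := sqrt_a_gt0 sz; have sb0 := sqrt_ab_gt0 sz.
rewrite scalerBr !scalerA -addrA; congr (_ + _).
rewrite -opprD -scalerDl; congr (- (_ *: _)).
by rewrite twice_energy /normal_coeff qr qrr; field; rewrite !gt_eqF.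
Qed.

Lemma etaA_unit z v : unit z -> etaA G a b eps z v = (2 * Num.sqrt (a 2^-1))^-1 * g z v.1 z.2.
Proof.
move=> uz; rewrite /etaA etaE; last exact: unit_slit uz.
rewrite /sqnorm uz.2 sqrtr1 divr1.
have s0 : 0 < Num.sqrt (a 2^-1) by rewrite sqrtr_gt0 a_gt0// invr_ge0.
transitivity ((eps * eps) * ((2 * Num.sqrt (a 2^-1))^-1 * g z v.1 z.2)).
  by field; rewrite gt_eqF.
by rewrite eps2 mul1r.
Qed.

Lemma smooth_energy : smooth_on slit (energy G).
Proof.
apply: smooth_onM => //; first exact: smooth_on_cst.
by apply: (smooth_gform lm); exact: (smooth_fiber lm).
Qed.

Lemma smooth_sqnorm : smooth_on slit q.
Proof. by apply: (smooth_gform lm); exact: (smooth_fiber lm). Qed.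

Lemma smooth_a_energy : smooth_on slit (fun z => a (energy G z)).
Proof. by apply: smooth_on_half_line => //; [exact: energy_ge0|exact: smooth_energy]. Qed.

Lemma smooth_b_energy : smooth_on slit (fun z => b (energy G z)).
Proof. by apply: smooth_on_half_line => //; [exact: energy_ge0|exact: smooth_energy]. Qed.

Lemma smooth_sqrt_a : smooth_on slit sa.
Proof.
apply: smooth_on_sqrt => //; last exact: smooth_a_energy.
by move=> z /energy_ge0; exact: a_gt0.
Qed.

Lemma smooth_sqrt_ab : smooth_on slit sab.
Proof.
apply: smooth_on_sqrt => //; first exact: sqrt_ab_arg_gt0.
apply: smooth_onD => //; first exact: smooth_a_energy.
apply: smooth_onM => //; last exact: smooth_energy.
by apply: smooth_onM => //; [exact: smooth_on_cst|exact: smooth_b_energy].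
Qed.

(** The simplified parts of [xiA] and [phiA] are valid on the slit bundle only; comparison with a
    model field V there suffices, as that set is open. *)
Lemma smooth_split (U V : E -> E) : smooth_on slit (fun z => (V z).1) ->
  smooth_on slit (fun z => vp z (V z)) ->
  (forall z, slit z -> (U z).1 = (V z).1) ->
  (forall z, slit z -> vp z (U z) = vp z (V z)) -> smooth_on slit U.
Proof.
move=> s1 s2 e1 e2.
apply: (@smooth_on_ext _ _ _ _ (fun z => hlift G z (V z).1 + vlift (vp z (V z)))) => //.
  by move=> z sz; rewrite -bundle_split; apply: (bundle_eq (G := G) (z := z)); rewrite ?e1 ?e2.
by apply: smooth_onD => //; [exact: (smooth_hlift lm)|exact: (smooth_vlift lm)].
Qed.

Definition xi_h (z : E) : rV := (2 * Num.sqrt (a 2^-1) * (Num.sqrt (q z))^-1) *: z.2.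

Lemma smooth_xi_h : smooth_on slit xi_h.
Proof.
apply: smooth_onZ => //; last exact: (smooth_fiber lm).
apply: smooth_onM => //; first exact: smooth_on_cst.
apply: smooth_onV => //.
  by move=> z /sqnorm_gt0; rewrite -sqrtr_gt0 => /gt_eqF ->.
by apply: smooth_on_sqrt => //; [exact: sqnorm_gt0|exact: smooth_sqnorm].
Qed.

Definition phi_h (V : E -> E) (z : E) : rV :=
  - (sa z *: vp z (V z)) + ((q z)^-1 * (sa z + eps * sab z) * g z (vp z (V z)) z.2) *: z.2.

Definition phi_v (V : E -> E) (z : E) : rV :=
  (sa z)^-1 *: ((V z).1 - ((q z)^-1 * g z (V z).1 z.2) *: z.2).

Lemma smooth_phi_h V : smooth_on slit V -> smooth_on slit (phi_h V).
Proof.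
move=> sV; have sP := smooth_vpart lm sV.
apply: smooth_onD => //.
  by apply: smooth_onN => //; apply: smooth_onZ => //; exact: smooth_sqrt_a.
apply: smooth_onZ => //; last exact: (smooth_fiber lm).
apply: smooth_onM => //; last by apply: (smooth_gform lm) => //; exact: (smooth_fiber lm).
apply: smooth_onM => //.
  by apply: smooth_onV => //; [move=> z /sqnorm_gt0 /gt_eqF ->|exact: smooth_sqnorm].
apply: smooth_onD => //; first exact: smooth_sqrt_a.
by apply: smooth_onM => //; [exact: smooth_on_cst|exact: smooth_sqrt_ab].
Qed.

Lemma smooth_phi_v V : smooth_on slit V -> smooth_on slit (phi_v V).
Proof.
move=> sV; have sX := smooth_on_fst os sV.
apply: smooth_onZ => //.
  by apply: smooth_onV => //; [move=> z /sqrt_a_gt0 /gt_eqF ->|exact: smooth_sqrt_a].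
apply: smooth_onB => //; apply: smooth_onZ => //; last exact: (smooth_fiber lm).
apply: smooth_onM => //; last by apply: (smooth_gform lm) => //; exact: (smooth_fiber lm).
by apply: smooth_onV => //; [move=> z /sqnorm_gt0 /gt_eqF ->|exact: smooth_sqnorm].
Qed.

Lemma bundle_field_xi : bundle_field O G (xiA G a b eps).
Proof.
apply/(bundle_fieldP lm); split=> [|z uz]; last first.
  by rewrite /tangent xiA_v ?gform0l//; exact: unit_slit uz.
apply: (@smooth_split _ (fun z => hlift G z (xi_h z))).
- exact: smooth_xi_h.
- by under eq_fun do rewrite vpart_hlift; exact: smooth_on_cst.
- by move=> z sz; rewrite xiA_h.
- by move=> z sz; rewrite xiA_v// vpart_hlift.
Qed.

Lemma bundle_field_phi V : bundle_field O G V ->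
  bundle_field O G (fun z => phiA G a b eps z (V z)).
Proof.
move=> /(bundle_fieldP lm) [sV tV]; apply/(bundle_fieldP lm); split=> [|z uz]; last first.
  have sz := unit_slit uz.
  rewrite /tangent phiA_v// gformZl gformDl gformNl gformZl /sqnorm uz.2 invr1 mul1r mulr1 subrr.
  by rewrite mulr0.
have vE z : vp z (hlift G z (phi_h V z) + vlift (phi_v V z)) = phi_v V z.
  by rewrite vpartD vpart_hlift vpart_vlift add0r.
apply: (@smooth_split _ (fun z => hlift G z (phi_h V z) + vlift (phi_v V z))).
- by under eq_fun do rewrite /= addr0; exact: smooth_phi_h.
- by under eq_fun do rewrite vE; exact: smooth_phi_v.
- by move=> z sz; rewrite phiA_h//= addr0.
- by move=> z sz; rewrite phiA_v// vE.
Qed.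

(** This lets the coefficients of the structure, which vary off the unit bundle, be differentiated
    as constants along tangent fields. *)
Lemma derive_unit_cst (f : E -> R) c z v : unit z -> tangent G z v ->
  differentiable f z -> (forall w, unit w -> f w = c) -> 'D_v f z = 0.
Proof.
move=> uz tv df fc.
have d0 : differentiable (fun w => f w - c) z by apply: differentiableB.
have := derive_unit_eq0 lm uz tv d0.
rewrite deriveB; [|exact: diff_derivable|exact: derivable_cst].
rewrite derive_cst subr0; apply => w uw; by rewrite fc// subrr.
Qed.

End InducedStructure.

(** * Structure equations of the bundle and the Koszul formula *)

Section Koszul.
Context {R : realType} {n : nat}.
Local Notation rV := 'rV[R]_n.
Local Notation E := (bundle R n).
Variables (O : set rV) (G : rV -> 'M[R]_n).
Hypothesis lm : local_metric O G.
Local Notation g z := (gform G z.1).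
Local Notation Gam z := (christoffel_form G z.1).
Local Notation slit := (@slit_bundle R n O).
Local Notation unit := (unit_bundle O G).
Local Notation vp := (vpart G).
Let os := open_slit lm.
Let gC := gform_sym lm.

Lemma is_deriveDE (V W : normedModType R) (f h : V -> W) (z v : V) df dh :
  is_derive z v f df -> is_derive z v h dh ->
  is_derive z v (fun w => f w + h w) (df + dh).
Proof. exact: is_deriveD. Qed.

Lemma is_deriveP (V W : normedModType R) (f : V -> W) (z v : V) :
  differentiable f z -> is_derive z v f ('D_v f z).
Proof. by move=> df; exact/derivableP/diff_derivable. Qed.

Lemma hcov_ext v X Y z : (\near z, X z = Y z) -> hcov G v X z = hcov G v Y z.
Proof.
by move=> XY; rewrite !hcovE (near_eq_derive _ XY) (nbhs_singleton XY).
Qed.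

Lemma hcovZ v (f : E -> R) X z : differentiable f z -> differentiable X z ->
  hcov G v (fun w => f w *: X w) z = f z *: hcov G v X z + 'D_v f z *: X z.
Proof.
move=> df dX; rewrite !hcovE.
have H := is_derive_scale df dX (is_deriveP v df) (is_deriveP v dX).
by rewrite (@derive_val _ _ _ _ _ _ _ H) GamZr scalerDr addrAC.
Qed.

Lemma hcovD v X Y z : differentiable X z -> differentiable Y z ->
  hcov G v (fun w => X w + Y w) z = hcov G v X z + hcov G v Y z.
Proof.
move=> dX dY; rewrite !hcovE.
have H := is_deriveDE (is_deriveP v dX) (is_deriveP v dY).
by rewrite (@derive_val _ _ _ _ _ _ _ H) GamDr addrACA.
Qed.

Lemma hcovN v X z : differentiable X z -> hcov G v (fun w => - X w) z = - hcov G v X z.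
Proof.
move=> dX; rewrite !hcovE.
have H := is_deriveN (is_deriveP v dX).
by rewrite [X in X + _](@derive_val _ _ _ _ _ _ _ H) GamNr opprD.
Qed.

Lemma bracket_h (U V : E -> E) z : O z.1 -> differentiable U z -> differentiable V z ->
  (lie_bracket U V z).1 =
  hcov G (U z) (fun w => (V w).1) z - hcov G (V z) (fun w => (U w).1) z.
Proof.
move=> Oz dU dV; rewrite !hcovE /lie_bracket.
have HU := is_derive_fst (is_deriveP (V z) dU).
have HV := is_derive_fst (is_deriveP (U z) dV).
rewrite (@derive_val _ _ _ _ _ _ _ HU) (@derive_val _ _ _ _ _ _ _ HV).
rewrite (GamC lm (V z).1 _ Oz).
move: (derive V z (U z)) (derive U z (V z)) (Gam z (U z).1 (V z).1) => A B C.
by rewrite opprD addrACA subrr addr0.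
Qed.

(** Expansion in raw coordinates; once antisymmetrised in two fields, the terms with derivatives and
    products of Christoffel symbols assemble into the curvature. *)
Lemma hcov_vpart (U : E -> E) z v : O z.1 -> differentiable U z ->
  hcov G v (fun w => vp w (U w)) z =
  ('D_v U z).2 + (dchristoffel_form G z.1 v.1 (U z).1 z.2 +
    Gam z ('D_v U z).1 z.2 + Gam z (U z).1 v.2) + Gam z v.1 (vp z (U z)).
Proof.
move=> Oz dU; rewrite hcovE; congr (_ + _).
have HU := is_deriveP v dU.
have H1 := is_derive_snd HU.
have H2 := is_derive_Gam lm (pi := fst) (X := fun w => (U w).1) (Y := snd) (v := v) Oz (diff_fst z)
  (is_derive_fst HU) (is_derive_snd (is_derive_id z v)).
rewrite derive_fst in H2.
exact: (@derive_val _ _ _ _ _ _ _ (is_deriveDE H1 H2)).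
Qed.

Lemma bracket_v (U V : E -> E) z : O z.1 -> differentiable U z -> differentiable V z ->
  vp z (lie_bracket U V z) =
  hcov G (U z) (fun w => vp w (V w)) z - hcov G (V z) (fun w => vp w (U w)) z
  - curv G z.1 (U z).1 (V z).1 z.2.
Proof.
move=> Oz dU dV; rewrite !hcov_vpart// curvE /lie_bracket vpartD vpartN /vpart.
rewrite !GamDr.
do 2 match goal with
  |- context [derive ?f ?x ?v] => generalize (derive f x v); intros [? ?] end.
move: (U z) (V z) => [u1 u2] [v1 v2] /=.
by row_ring.
Qed.

Variables (a b : R -> R).
Hypothesis a_smooth : smooth_half_line a.
Hypothesis b_smooth : smooth_half_line b.
Hypothesis a_gt0 : forall t : R, 0 <= t -> 0 < a t.
Local Notation a0 := (a 2^-1).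
Local Notation GAA := (GA G a b).

(* 4 a(1/2) times GA on vectors tangent to the unit bundle; the two functions
   differ off it. *)
Definition sasaki_form (z v w : E) : R := g z v.1 w.1 + a0 * g z (vp z v) (vp z w).

Lemma sasaki_formC z v w : O z.1 -> sasaki_form z v w = sasaki_form z w v.
Proof. by move=> Oz; rewrite /sasaki_form (gC v.1)// (gC (vp z v)). Qed.

Lemma sasaki_formBl z v v' w : sasaki_form z (v - v') w = sasaki_form z v w - sasaki_form z v' w.
Proof.
rewrite /sasaki_form (_ : (v - v').1 = v.1 - v'.1)// vpartD vpartN.
move: (vp z v) (vp z v') => p p'; rewrite !gformDl !gformNl.
by ring.
Qed.

Lemma sasaki_formDl z v v' w : sasaki_form z (v + v') w = sasaki_form z v w + sasaki_form z v' w.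
Proof.
rewrite /sasaki_form (_ : (v + v').1 = v.1 + v'.1)// vpartD.
move: (vp z v) (vp z v') => p p'; rewrite !gformDl.
by ring.
Qed.

Lemma sasaki_formZl z c v w : sasaki_form z (c *: v) w = c * sasaki_form z v w.
Proof.
rewrite /sasaki_form (_ : (c *: v).1 = c *: v.1)// vpartZ.
move: (vp z v) => p; rewrite !gformZl.
by ring.
Qed.

Lemma GA_sasaki_formr z v w : unit z -> tangent G z w ->
  GAA z v w = (4 * a0)^-1 * sasaki_form z v w.
Proof.
move=> uz tw; rewrite /GA /gA /hpart (energy_unit uz) tw mulr0 addr0.
by [].
Qed.

Lemma GA_sasaki_forml z v w : unit z -> tangent G z v ->
  GAA z v w = (4 * a0)^-1 * sasaki_form z v w.
Proof.
move=> uz tv; rewrite /GA /gA /hpart (energy_unit uz) tv mulr0 mul0r addr0.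
by [].
Qed.

(** The b term contains two factors that vanish at z by tangency, so the product rule leaves nothing
    of it; the coefficient a has zero derivative along v. *)
Lemma derive_GA (V W : E -> E) z v : unit z -> tangent G z v ->
  bundle_field O G V -> bundle_field O G W ->
  'D_v (fun w => GAA w (V w) (W w)) z = (4 * a0)^-1 *
  (g z (hcov G v (fun w => (V w).1) z) (W z).1 + g z (V z).1 (hcov G v (fun w => (W w).1) z) +
   a0 * (g z (hcov G v (fun w => vp w (V w)) z) (vp z (W z)) +
         g z (vp z (V z)) (hcov G v (fun w => vp w (W w)) z))).
Proof.
move=> uz tv /(bundle_fieldP lm) [sV tV] /(bundle_fieldP lm) [sW tW].
have sz := unit_slit uz; have Oz := uz.1.
have d1 (X : E -> E) : smooth_on slit X -> differentiable (fun w : E => (X w).1 : rV) z.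
  by move=> sX; exact: smooth_on_diff (smooth_on_fst os sX) sz.
have d2 (X : E -> E) : smooth_on slit X -> differentiable (fun w : E => vp w (X w)) z.
  by move=> sX; exact: smooth_on_diff (smooth_vpart lm sX) sz.
have Ha : is_derive z v (fun w => a (energy G w)) 0.
  have d := smooth_on_diff (smooth_a_energy lm a_smooth) sz.
  rewrite -(derive_unit_cst lm (c := a0) uz tv d); first exact: is_deriveP.
  by move=> w uw; rewrite (energy_unit uw).
have Hb : is_derive z v (fun w => b (energy G w)) 0.
  have d := smooth_on_diff (smooth_b_energy lm b_smooth) sz.
  rewrite -(derive_unit_cst lm (c := b 2^-1) uz tv d); first exact: is_deriveP.
  by move=> w uw; rewrite (energy_unit uw).
have H1 := is_derive_gform_cov lm v Oz (d1 _ sV) (d1 _ sW).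
have H2 := is_derive_gform_cov lm v Oz (d2 _ sV) (d2 _ sW).
have H3 := is_derive_gform_cov lm v Oz (d2 _ sV) (diff_snd z).
have H4 := is_derive_gform_cov lm v Oz (d2 _ sW) (diff_snd z).
have H5 := is_deriveDE H1 (is_deriveDE (is_deriveME Ha H2) (is_deriveME (is_deriveME Hb H3) H4)).
have H6 := is_deriveME (is_derive_cst ((4 * a0)^-1 : R) z v) H5.
rewrite [LHS](@derive_val _ _ _ _ _ _ _ H6) (energy_unit uz) (tV z uz) (tW z uz) /cst.
by ring.
Qed.

Variable nabla : (E -> E) -> (E -> E) -> E -> E.
Hypothesis LC : levi_civita O G a b nabla.

Lemma koszul (U V W : E -> E) z : unit z ->
  bundle_field O G U -> bundle_field O G V -> bundle_field O G W ->
  2 * sasaki_form z (nabla U V z) (W z) =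
  2 * g z (hcov G (U z) (fun w => (V w).1) z) (W z).1 +
  2 * a0 * g z (hcov G (U z) (fun w => vp w (V w)) z) (vp z (W z)) -
  a0 * (g z (curv G z.1 (U z).1 (V z).1 z.2) (vp z (W z)) -
        g z (curv G z.1 (U z).1 (W z).1 z.2) (vp z (V z)) -
        g z (curv G z.1 (V z).1 (W z).1 z.2) (vp z (U z))).
Proof.
move=> uz fU fV fW; have sz := unit_slit uz; have Oz := uz.1.
have tan X : bundle_field O G X -> tangent G z (X z).
  by move=> /(bundle_fieldP lm) [_]; exact.
have dif X : bundle_field O G X -> differentiable X z.
  by move=> [sX _]; exact: smooth_on_diff sX sz.
have c0 : (4 * a0)^-1 != 0.
  by rewrite invr_neq0// mulf_neq0 ?pnatr_eq0// gt_eqF// a_gt0// invr_ge0.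
(* M and T are the metric and torsion axioms written with [sasaki_form] and covariant derivatives;
   three instances of each give the formula by linear arithmetic. *)
have M X Y Z : bundle_field O G X -> bundle_field O G Y -> bundle_field O G Z ->
    g z (hcov G (X z) (fun w => (Y w).1) z) (Z z).1 +
    g z (Y z).1 (hcov G (X z) (fun w => (Z w).1) z) +
    a0 * (g z (hcov G (X z) (fun w => vp w (Y w)) z) (vp z (Z z)) +
         g z (vp z (Y z)) (hcov G (X z) (fun w => vp w (Z w)) z)) =
    sasaki_form z (nabla X Y z) (Z z) + sasaki_form z (nabla X Z z) (Y z).
  move=> fX fY fZ; have := lc_metric LC fX fY fZ uz.
  rewrite derive_GA//; last exact: tan.
  rewrite (GA_sasaki_formr _ uz (tan _ fZ)) (GA_sasaki_forml _ uz (tan _ fY)) -mulrDr.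
  move=> /(mulfI c0) ->.
  by rewrite (sasaki_formC (Y z)).
have T X Y Z : bundle_field O G X -> bundle_field O G Y -> bundle_field O G Z ->
    sasaki_form z (nabla X Y z) (Z z) - sasaki_form z (nabla Y X z) (Z z) =
    g z (hcov G (X z) (fun w => (Y w).1) z) (Z z).1 -
    g z (hcov G (Y z) (fun w => (X w).1) z) (Z z).1 +
    a0 * (g z (hcov G (X z) (fun w => vp w (Y w)) z) (vp z (Z z)) -
          g z (hcov G (Y z) (fun w => vp w (X w)) z) (vp z (Z z)) -
          g z (curv G z.1 (X z).1 (Y z).1 z.2) (vp z (Z z))).
  move=> fX fY fZ; rewrite -sasaki_formBl (lc_torsion_free LC fX fY uz) /sasaki_form.
  rewrite (bracket_h Oz (dif _ fX) (dif _ fY)) (bracket_v Oz (dif _ fX) (dif _ fY)).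
  by rewrite !gformDl !gformNl.
have := M U V W fU fV fW; have := M V U W fV fU fW; have := M W U V fW fU fV.
have := T U V W fU fV fW; have := T U W V fU fW fV; have := T V W U fV fW fU.
have gCz u v : g z u v = g z v u by exact: gC.
(* Covariant derivatives are moved to the left of each product, so that [lra] sees every product as
   one atom. *)
rewrite !(gCz (V z).1 (hcov _ _ _ _)) !(gCz (vp z (V z)) (hcov _ _ _ _)).
rewrite !(gCz (U z).1 (hcov _ _ _ _)) !(gCz (vp z (U z)) (hcov _ _ _ _)).
lra.
Qed.

End Koszul.

(** * K-contact and Sasakian identities over one chart *)

Section ContactLocal.
Context {R : realType} {n : nat}.
Local Notation rV := 'rV[R]_n.
Local Notation E := (bundle R n).
Variables (O : set rV) (G : rV -> 'M[R]_n).
Hypothesis lm : local_metric O G.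
Variables (a b : R -> R) (eps : R).
Hypothesis a_smooth : smooth_half_line a.
Hypothesis b_smooth : smooth_half_line b.
Hypothesis a_gt0 : forall t : R, 0 <= t -> 0 < a t.
Hypothesis b_ge0 : forall t : R, 0 <= t -> 0 <= b t.
Hypothesis eps2 : eps * eps = 1.
Variable nabla : (E -> E) -> (E -> E) -> E -> E.
Hypothesis LC : levi_civita O G a b nabla.
Local Notation g z := (gform G z.1).
Local Notation slit := (@slit_bundle R n O).
Local Notation unit := (unit_bundle O G).
Local Notation vp := (vpart G).
Local Notation field := (bundle_field O G).
Local Notation xi := (xiA G a b eps).
Local Notation phi := (phiA G a b eps).
Local Notation s := (Num.sqrt (a 2^-1)).
Let os := open_slit lm.
Let gC := gform_sym lm.

Let s_gt0 : 0 < s.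
Proof. by rewrite sqrtr_gt0 a_gt0// invr_ge0. Qed.

Let ss : a 2^-1 = s * s.
Proof. by rewrite -expr2 sqr_sqrtr// ltW// a_gt0// invr_ge0. Qed.

Let sqrt_a_unit z : unit z -> sqrt_a G a z = s.
Proof. by move=> uz; rewrite /sqrt_a (energy_unit uz). Qed.

Let sqnorm_unit z : unit z -> sqnorm G z = 1. Proof. by case. Qed.

Lemma field_tangent U z : field U -> unit z -> tangent G z (U z).
Proof. by move=> /(bundle_fieldP lm) [_]; exact. Qed.

Lemma tangentD z v w : tangent G z v -> tangent G z w -> tangent G z (v + w).
Proof.
rewrite /tangent vpartD; move: (vp z v) (vp z w) => p p' tp tp'.
by rewrite gformDl tp tp' addr0.
Qed.

Lemma tangentZ z c v : tangent G z v -> tangent G z (c *: v).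
Proof. by rewrite /tangent vpartZ gformZl => ->; rewrite mulr0. Qed.

Lemma tangentN z v : tangent G z v -> tangent G z (- v).
Proof. by rewrite -scaleN1r; exact: tangentZ. Qed.

Lemma vertical_field (Q : E -> rV) : smooth_on slit Q ->
  field (fun w => vlift (Q w - ((sqnorm G w)^-1 * g w (Q w) w.2) *: w.2)).
Proof.
move=> sQ; apply/(bundle_fieldP lm); split=> [|w uw]; last first.
  rewrite /tangent vpart_vlift gformDl gformNl gformZl.
  by rewrite (sqnorm_unit uw) uw.2 invr1; ring.
apply: (smooth_vlift lm); apply: smooth_onB => //.
apply: smooth_onZ => //; last exact: (smooth_fiber lm).
apply: smooth_onM => //; last by apply: (smooth_gform lm) => //; exact: (smooth_fiber lm).
by apply: smooth_onV => //; [move=> w /(sqnorm_gt0 lm) /gt_eqF ->|exact: (smooth_sqnorm lm)].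
Qed.

Lemma horizontal_field X : field (fun w => hlift G w X).
Proof.
apply/(bundle_fieldP lm); split=> [|w _]; last by rewrite /tangent vpart_hlift gform0l.
by apply: (smooth_hlift lm); exact: smooth_on_cst.
Qed.

(** Constant components in the chart, with the vertical one projected off u to stay tangent away
    from z. *)
Lemma tangent_extension z v : unit z -> tangent G z v ->
  exists2 W, field W & W z = v.
Proof.
move=> uz tv; pose Q := vp z v.
have [sh th] := (bundle_fieldP lm _).1 (horizontal_field v.1).
have sQ : smooth_on slit (fun=> Q) by exact: smooth_on_cst.
have [sv tv'] := (bundle_fieldP lm _).1 (vertical_field sQ).
exists (fun w => hlift G w v.1 + vlift (Q - ((sqnorm G w)^-1 * g w Q w.2) *: w.2)).
  apply/(bundle_fieldP lm); split=> [|w uw]; first exact: smooth_onD.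
  by apply: tangentD; [exact: th|exact: tv'].
by rewrite tv mulr0 scale0r subr0 -bundle_split.
Qed.

(** Testing against an extension of v itself gives a sum of two nonnegative squares equal to 0. *)
Lemma tangent_eq0 z v : unit z -> tangent G z v ->
  (forall W, field W -> sasaki_form G a z v (W z) = 0) -> v = 0.
Proof.
move=> uz tv H; have [W fW Wz] := tangent_extension uz tv.
have := H W fW; rewrite Wz /sasaki_form => /eqP.
have pos u : 0 <= g z u u.
  have [->|u0] := eqVneq u 0; first by rewrite gform0l.
  by apply/ltW/(lm_pos lm uz.1).
have a0 : 0 < a 2^-1 by rewrite ss mulr_gt0.
rewrite paddr_eq0 ?mulr_ge0//; last exact: ltW.
rewrite mulf_eq0 (gt_eqF a0)/= !(gform_eq0 lm _ uz.1) => /andP[/eqP v1 /eqP v2].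
by apply: (bundle_eq (G := G) (z := z)); rewrite ?v1 ?v2// /vpart /= Gam0l addr0.
Qed.

Lemma xiA_unit z : unit z -> (xi z).1 = (2 * s) *: z.2.
Proof.
move=> uz; have sz := unit_slit uz.
by rewrite (xiA_h lm)// (sqnorm_unit uz) sqrtr1 invr1 mulr1.
Qed.

Lemma phiA_unit_h z v : unit z -> tangent G z v -> (phi z v).1 = - (s *: vp z v).
Proof.
move=> uz tv; have sz := unit_slit uz.
by rewrite (phiA_h lm)// tv mulr0 scale0r addr0 (sqrt_a_unit uz).
Qed.

Lemma phiA_unit_v z v : unit z ->
  vp z (phi z v) = s^-1 *: (v.1 - g z v.1 z.2 *: z.2).
Proof.
move=> uz; have sz := unit_slit uz.
by rewrite (phiA_v lm)// (sqrt_a_unit uz) (sqnorm_unit uz) invr1 mul1r.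
Qed.

Lemma sasaki_form_phi z v w : unit z -> tangent G z v -> tangent G z w ->
  sasaki_form G a z (phi z v) w = s * (g z v.1 (vp z w) - g z (vp z v) w.1).
Proof.
move=> uz tv tw; rewrite /sasaki_form phiA_unit_h// phiA_unit_v//.
rewrite gformNl !gformZl gformDl gformNl gformZl (gC z.2 _ uz.1) tw.
move: s_gt0 ss; move: s => t t0 ->.
by field; rewrite gt_eqF.
Qed.

Lemma sasaki_form_phi_skew z v w : unit z -> tangent G z v -> tangent G z w ->
  sasaki_form G a z (phi z v) w = - sasaki_form G a z v (phi z w).
Proof.
move=> uz tv tw; rewrite (sasaki_form_phi uz tv tw).
rewrite (sasaki_formC lm a v (phi z w) uz.1) (sasaki_form_phi uz tw tv).
by rewrite (gC w.1 _ uz.1) (gC (vp z w) _ uz.1); ring.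
Qed.

Lemma koszul_xi U W z : unit z -> field U -> field W ->
  2 * sasaki_form G a z (nabla U xi z) (W z) =
  2 * s * (2 * g z (vp z (U z)) (W z).1 -
     a 2^-1 * (g z (curv G z.1 (U z).1 z.2 z.2) (vp z (W z)) -
               g z (curv G z.1 z.2 (W z).1 z.2) (vp z (U z)))).
Proof.
move=> uz fU fW; have sz := unit_slit uz; have Oz := uz.1.
have fxi : field xi by exact: (bundle_field_xi lm).
rewrite (koszul lm a_smooth b_smooth a_gt0 LC uz fU fxi fW).
(* The coefficient of u in xi is constant on the unit bundle, so only the derivative of u
   contributes. *)
have -> : hcov G (U z) (fun w => (xi w).1) z = (2 * s) *: vp z (U z).
  pose f (w : E) := 2 * s * (Num.sqrt (sqnorm G w))^-1.
  have sf : smooth_on slit f.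
    apply: smooth_onM => //; first exact: smooth_on_cst.
    apply: smooth_onV => //.
      by move=> w /(sqnorm_gt0 lm); rewrite -sqrtr_gt0 => /gt_eqF ->.
    by apply: smooth_on_sqrt => //; [exact: (sqnorm_gt0 lm)|exact: (smooth_sqnorm lm)].
  have fu w : unit w -> f w = 2 * s.
    by move=> uw; rewrite /f (sqnorm_unit uw) sqrtr1 invr1 mulr1.
  have df := smooth_on_diff sf sz.
  rewrite (@hcov_ext _ _ _ _ _ (fun w => f w *: w.2)); last first.
    by apply: filterS (slit_nbhs lm sz) => w sw; rewrite (xiA_h lm).
  rewrite (hcovZ G _ df (diff_snd z)) hcov_fiber fu//.
  by rewrite (derive_unit_cst lm uz (field_tangent fU uz) df fu) scale0r addr0.
have -> : hcov G (U z) (fun w => vp w (xi w)) z = 0.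
  rewrite (@hcov_ext _ _ _ _ _ (fun=> 0)); last first.
    by apply: filterS (slit_nbhs lm sz) => w sw; rewrite (xiA_v lm).
  by rewrite hcovE derive_cst Gam0r addr0.
rewrite (xiA_unit uz) (xiA_v lm eps a_gt0 b_ge0 sz).
rewrite (curvZ2 lm _ _ _ _ Oz) (curvZ1 lm _ _ _ _ Oz) !gformZl gform0l gform0r.
by ring.
Qed.

Lemma K_contact_local U z : unit z -> field U ->
  (forall X Y Z, curv G z.1 X Y Z = (a 2^-1)^-1 *: (g z Y Z *: X - g z X Z *: Y)) ->
  nabla U xi z = - phi z (U z).
Proof.
move=> uz fU Hc; have Oz := uz.1.
have fxi : field xi by exact: (bundle_field_xi lm).
have fphi := bundle_field_phi lm eps a_smooth b_smooth a_gt0 b_ge0 fU.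
have tU := field_tangent fU uz.
apply/eqP; rewrite -subr_eq0 opprK; apply/eqP.
apply: (tangent_eq0 uz).
  apply: tangentD; first exact: (field_tangent (lc_field LC fU fxi) uz).
  exact: (field_tangent fphi uz).
move=> W fW; have tW := field_tangent fW uz.
apply: (mulfI (x := 2)); first by rewrite pnatr_eq0.
rewrite mulr0 sasaki_formDl mulrDr koszul_xi// (sasaki_form_phi uz tU tW) !Hc.
move: tU tW uz.2; rewrite /tangent; move: (vp z (U z)) (vp z (W z)) => p p' tU tW yy.
rewrite !gformZl !gformDl !gformNl !gformZl yy (gC z.2 p' Oz) tW (gC z.2 p Oz) tU.
rewrite (gC (W z).1 p Oz).
move: s_gt0 ss; move: s => t t0 ->.
by field; rewrite gt_eqF.
Qed.

(** With U vertical at z and W the horizontal lift of X, the formula for nabla_U xi keeps one metric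
    term and one curvature term; the K-contact equation equates them. *)
Lemma K_contact_curv U z P : unit z -> field U -> g z P z.2 = 0 -> U z = vlift P ->
  nabla U xi z = - phi z (U z) ->
  forall X, g z (curv G z.1 X z.2 z.2) P = (a 2^-1)^-1 * g z X P.
Proof.
move=> uz fU Py Uz K X; have Oz := uz.1.
have fW := horizontal_field X.
have := koszul_xi uz fU fW.
have tU := field_tangent fU uz; have tW := field_tangent fW uz.
rewrite K -scaleN1r sasaki_formZl (sasaki_form_phi uz tU tW).
rewrite Uz vpart_vlift vpart_hlift /= !gform0r (curv_anti _ _ X) gformNl.
rewrite (gC X P Oz).
move: s_gt0 ss; move: s => t t0 -> H.
have tt : 2 * t * (t * t) != 0 by rewrite !mulf_neq0 ?gt_eqF.
apply: (mulfI tt); rewrite [RHS](_ : _ = 2 * t * g z P X); last first.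
  by field; rewrite gt_eqF.
by move: H; lra.
Qed.

(** Skewness moves phi from nabla_U V onto the test vector, so two Koszul formulas cover the left
    side. The covariant derivatives of the parts of V cancel between them, except for the component
    along u of the vertical one, which tangency determines. *)
Lemma Sasakian_local U V z : unit z -> field U -> field V ->
  (forall X Y Z, curv G z.1 X Y Z = (a 2^-1)^-1 *: (g z Y Z *: X - g z X Z *: Y)) ->
  nabla U (fun w => phi w (V w)) z - phi z (nabla U V z) =
  GA G a b z (U z) (V z) *: xi z - etaA G a b eps z (V z) *: U z.
Proof.
move=> uz fU fV Hc; have sz := unit_slit uz; have Oz := uz.1.
have fxi : field xi by exact: (bundle_field_xi lm).
have fphi W := bundle_field_phi (V := W) lm eps a_smooth b_smooth a_gt0 b_ge0.
have fpV := fphi V fV; have fN := lc_field LC fU fV.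
have tan W fW := @field_tangent W z fW uz.
have [tU tV] := (tan U fU, tan V fV); have tN := tan _ fN.
have tphi v : tangent G z v -> tangent G z (phi z v).
  move=> tv; rewrite /tangent phiA_unit_v// gformZl gformDl gformNl gformZl uz.2.
  by rewrite mulr1 subrr mulr0.
have tpN := tphi _ tN; have txi := tan _ fxi.
have phiN W : field W -> sasaki_form G a z (phi z (nabla U V z)) (W z) =
    - sasaki_form G a z (nabla U V z) (phi z (W z)) by move=> /tan; exact: sasaki_form_phi_skew.
have xi1 := xiA_unit uz; have xi2 := xiA_v lm eps a_gt0 b_ge0 sz.
move: (phi z (nabla U V z)) (xi z) tpN txi phiN xi1 xi2 => p x tp tx phiN xi1 xi2.
apply/eqP; rewrite -subr_eq0; apply/eqP; apply: (tangent_eq0 uz).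
  apply: tangentD; last apply: tangentN.
    by apply: tangentD; [exact: tan _ (lc_field LC fU fpV)|exact: tangentN].
  by apply: tangentD; [exact: tangentZ|apply: tangentN; exact: tangentZ].
move=> W fW; have tW := tan W fW; have fpW := fphi W fW.
rewrite !sasaki_formBl !sasaki_formZl phiN// opprK.
have K1 := koszul lm a_smooth b_smooth a_gt0 LC uz fU fpV fW.
have K2 := koszul lm a_smooth b_smooth a_gt0 LC uz fU fV fpW.
apply: (mulfI (x := 2)); first by rewrite pnatr_eq0.
rewrite mulr0 mulrBr mulrDr K1 K2 => {K1 K2}.
have [sX sP] : smooth_on slit (fun w => (V w).1 : rV) /\ smooth_on slit (fun w => vp w (V w)).
  by case: fV => sV _; split; [exact: smooth_on_fst|exact: (smooth_vpart lm)].
have dX := smooth_on_diff sX sz; have dP := smooth_on_diff sP sz.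
set hX := hcov G (U z) (fun w => (V w).1) z.
set hP := hcov G (U z) (fun w => vp w (V w)) z.
have dy := diff_snd z.
have near_slit := slit_nbhs lm sz.
(* Derivative along U of the tangency condition g(P_V, u) = 0. *)
have hPy : g z hP z.2 = - g z (vp z (V z)) (vp z (U z)).
  have H := is_derive_gform_cov lm (U z) Oz dP dy.
  have := derive_unit_cst lm (c := 0) uz tU
    (smooth_on_diff (smooth_gform lm sP (smooth_fiber lm)) sz).
  rewrite (@derive_val _ _ _ _ _ _ _ H) hcov_fiber => /(_ (fun w uw => field_tangent fV uw)).
  by move/eqP; rewrite addr_eq0 => /eqP.
have ssa := smooth_sqrt_a lm a_smooth a_gt0.
have dsa := smooth_on_diff ssa sz.
have Dsa := derive_unit_cst lm uz tU dsa sqrt_a_unit.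
have sq := smooth_sqnorm lm; have sfib := smooth_fiber lm.
have sqV : smooth_on slit (fun w => (sqnorm G w)^-1).
  by apply: smooth_onV => // w /(sqnorm_gt0 lm) /gt_eqF ->.
have dqV := smooth_on_diff sqV sz.
have DqV : 'D_(U z) (fun w => (sqnorm G w)^-1) z = 0.
  by apply: (derive_unit_cst lm uz tU dqV (c := 1)) => w uw; rewrite (sqnorm_unit uw) invr1.
(* The radial term of phi V has a coefficient vanishing on the unit bundle; both it and its
   derivative along U are 0 at z. *)
have -> : hcov G (U z) (fun w => (phi w (V w)).1) z = - (s *: hP).
  pose f (w : E) := (sqnorm G w)^-1 * (sqrt_a G a w + eps * sqrt_ab G a b w) *
    g w (vp w (V w)) w.2.
  have sf : smooth_on slit f.
    apply: smooth_onM => //; last exact: (smooth_gform lm).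
    apply: smooth_onM => //; apply: smooth_onD => //; apply: smooth_onM => //.
      exact: smooth_on_cst.
    exact: (smooth_sqrt_ab lm).
  have df := smooth_on_diff sf sz.
  have f0 w : unit w -> f w = 0.
    by move=> uw; rewrite /f (field_tangent fV uw) mulr0.
  have d1 : differentiable (fun w => sqrt_a G a w *: vp w (V w)) z.
    by apply: smooth_on_diff sz; exact: smooth_onZ.
  have d2 : differentiable (fun w => f w *: w.2) z.
    by apply: smooth_on_diff sz; exact: smooth_onZ.
  rewrite (@hcov_ext _ _ _ _ _ (fun w => - (sqrt_a G a w *: vp w (V w)) + f w *: w.2)); last first.
    by apply: filterS near_slit => w sw; rewrite (phiA_h lm).
  rewrite (hcovD G _ (differentiableN d1) d2) (hcovN G _ d1) (hcovZ G _ dsa dP) (hcovZ G _ df dy).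
  rewrite (derive_unit_cst lm uz tU df f0) (f0 z uz) Dsa (sqrt_a_unit uz).
  by rewrite !scale0r !addr0.
(* Here the radial coefficient h restricts to g(X_V, u), which is not constant, so its derivative
   and the derivative of u both survive. *)
have -> : hcov G (U z) (fun w => vp w (phi w (V w))) z =
    s^-1 *: (hX - ((g z hX z.2 + g z (V z).1 (vp z (U z))) *: z.2 + g z (V z).1 z.2 *: vp z (U z))).
  pose h (w : E) := (sqnorm G w)^-1 * g w (V w).1 w.2.
  have sh : smooth_on slit h by apply: smooth_onM => //; exact: (smooth_gform lm).
  have dh := smooth_on_diff sh sz.
  have Dh : 'D_(U z) h z = g z hX z.2 + g z (V z).1 (vp z (U z)).
    have H1 := is_derive_gform_cov lm (U z) Oz dX dy.
    have H2 := is_deriveME (is_deriveP (U z) dqV) H1.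
    rewrite (@derive_val _ _ _ _ _ _ _ H2) DqV mul0r add0r (sqnorm_unit uz) invr1 mul1r.
    by rewrite hcov_fiber.
  have hz : h z = g z (V z).1 z.2 by rewrite /h (sqnorm_unit uz) invr1 mul1r.
  have ssaV : smooth_on slit (fun w => (sqrt_a G a w)^-1).
    by apply: smooth_onV => // w /(sqrt_a_gt0 lm a_gt0) /gt_eqF ->.
  have dsaV := smooth_on_diff ssaV sz.
  have saV w : unit w -> (sqrt_a G a w)^-1 = s^-1 by move=> uw; rewrite (sqrt_a_unit uw).
  have d1 : differentiable (fun w => h w *: w.2) z.
    by apply: smooth_on_diff sz; exact: smooth_onZ.
  have d2 : differentiable (fun w => (V w).1 - h w *: w.2) z by exact: differentiableB.
  rewrite (@hcov_ext _ _ _ _ _ (fun w => (sqrt_a G a w)^-1 *: ((V w).1 - h w *: w.2))); last first.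
    by apply: filterS near_slit => w sw; rewrite (phiA_v lm).
  rewrite (hcovZ G _ dsaV d2) (derive_unit_cst lm uz tU dsaV saV) scale0r addr0 (saV z uz).
  rewrite (hcovD G _ dX (differentiableN d1)) (hcovN G _ d1) (hcovZ G _ dh dy) hcov_fiber Dh hz.
  by rewrite [X in - X]addrC.
move: (phiA_unit_h uz tV) (phiA_unit_h uz tW) (phiA_unit_v (V z) uz) (phiA_unit_v (W z) uz).
move: (phi z (V z)) (phi z (W z)) => pV pW -> -> -> ->.
rewrite !Hc.
rewrite (GA_sasaki_formr _ _ _ uz tV) (etaA_unit lm a_gt0 b_ge0 eps2 _ uz) /sasaki_form xi1 xi2.
move: tU tV tW hPy uz.2; rewrite /tangent.
move: (U z).1 (vp z (U z)) (V z).1 (vp z (V z)) (W z).1 (vp z (W z)) hX hP (z.2).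
move=> U1 U2 V1 V2 W1 W2 hX' hP' y tU tV tW hPy yy.
rewrite !(gformDl, gformDr, gformNl, gformNr, gformZl, gformZr, gform0l).
rewrite hPy (gC y W2 Oz) tW tV (gC y W1 Oz) (gC W1 V1 Oz) (gC W2 V2 Oz) (gC W2 U2 Oz) (gC V2 U2 Oz).
move: s_gt0 ss; move: s => t t0 ->.
by field; rewrite gt_eqF.
Qed.

End ContactLocal.

(** * Globally defined vertical fields *)

Section GlobalField.
Context {R : realType} {n : nat} {M : manifold R n}.
Local Notation rV := 'rV[R]_n.
Local Notation E := (bundle R n).
Variable g : riemannian_metric M.
Implicit Types i j k : chart M.

Lemma chart_metric i : local_metric (ccod i) (gram g i).
Proof.
split; [exact: cmap_open|exact: gram_smooth|exact: gram_sym|].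
by move=> x u Ox u0; exact: gram_posdef.
Qed.

Lemma cinvK i x : ccod i x -> cdom i (cinv i x) /\ cmap i (cinv i x) = x.
Proof. by move=> [p dp <-]; rewrite cmapK. Qed.

Lemma cinv_ccod i x : ccod i x -> {for x, continuous (cinv i)}.
Proof. exact: cinv_continuous. Qed.

Lemma cinv_nbhs i x (A : set M) : ccod i x -> open A -> A (cinv i x) ->
  \forall y \near x, ccod i y /\ A (cinv i y).
Proof.
move=> Ox oA Ax.
have H1 : nbhs x (ccod i) by apply: open_nbhs_nbhs; split=> //; exact: cmap_open.
have H2 : nbhs x (cinv i @^-1` A).
  by apply: (cinv_ccod Ox); apply: open_nbhs_nbhs; split.
exact: filterI H1 H2.
Qed.

Lemma overlapE i j x : (cmap i @` (cdom i `&` cdom j)) x <-> ccod i x /\ cdom j (cinv i x).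
Proof.
split=> [[p [ip jp] <-]|[Ox jx]].
  by split; [exists p|rewrite cmapK].
by exists (cinv i x); [split=> //; exact: (cinvK Ox).1|exact: (cinvK Ox).2].
Qed.

Lemma open_overlap i j : open (cmap i @` (cdom i `&` cdom j)).
Proof.
rewrite openE => x /overlapE [Ox jx].
have := cinv_nbhs Ox (cdom_open j) jx.
by apply: filterS => y /overlapE.
Qed.

Lemma transition_overlap i j x : ccod i x -> cdom j (cinv i x) ->
  (cmap j @` (cdom j `&` cdom i)) (transition i j x).
Proof. by move=> Ox jx; exists (cinv i x) => //; split=> //; exact: (cinvK Ox).1. Qed.

Lemma diff_transition i j x : ccod i x -> cdom j (cinv i x) ->
  differentiable (transition i j) x.
Proof. by move=> Ox jx; apply: (smooth_on_diff (@transition_smooth R n M i j)); apply/overlapE. Qed.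

(** The cocycle relation of the transition maps holds near x only, which is enough for the chain
    rule. *)
Lemma derive_transition_comp i j k x P : ccod i x -> cdom j (cinv i x) -> cdom k (cinv i x) ->
  'D_P (transition i k) x = 'D_('D_P (transition i j) x) (transition j k) (transition i j x).
Proof.
move=> Ox jx kx.
have tx : cinv j (transition i j x) = cinv i x by rewrite /transition /= cmapK.
have d1 := diff_transition Ox jx.
have d2 : differentiable (transition j k) (transition i j x).
  by apply: diff_transition; [exists (cinv i x)|rewrite tx].
rewrite -(derive_comp P d1 d2); apply: near_eq_derive.
have := cinv_nbhs Ox (cdom_open j) jx.
by apply: filterS => y [Oy jy]; rewrite /transition /= cmapK.
Qed.

Lemma derive_transition_self i x P : ccod i x -> 'D_P (transition i i) x = P.
Proof.
move=> Ox; rewrite (@near_eq_derive _ _ _ _ id) ?derive_id//.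
have := open_nbhs_nbhs (conj (@cmap_open R n M i) Ox).
by apply: filterS => y Oy; rewrite /transition /= (cinvK Oy).2.
Qed.

Section Field.
Variables (i : chart M) (x0 P : rV) (r : R).
Hypothesis r_gt0 : 0 < r.
Hypothesis ball_ccod : closed_ball x0 r `<=` ccod i.

(* The field P d/dx^i of the chart i, cut off by a bump function and extended by
   zero, read in the chart j. *)
Definition cutoff_field (j : chart M) (x : rV) : rV :=
  if asbool (cdom i (cinv j x)) then
    bump_function x0 r (cmap i (cinv j x)) *: 'D_P (transition i j) (cmap i (cinv j x))
  else 0.

(** The continuous image of a compact ball is compact, hence closed since M is Hausdorff; extension
    by zero is smooth for this reason. *)
Lemma closed_support : closed (cinv i @` closed_ball x0 r).
Proof.
apply: (compact_closed (points_hausdorff (m := M))); apply: continuous_compact.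
  apply: continuous_in_subspaceT => x /set_mem Kx; apply: cinv_ccod; exact: ball_ccod.
apply: bounded_closed_compact; last exact: closed_ball_closed.
exists (`|x0| + r); split; first exact: num_real.
move=> m rm x; rewrite closed_ballE// /closed_ball_/= => xr.
apply: le_trans (ltW rm).
rewrite -[x](subrK x0) addrC -[x - x0]opprB; apply: le_trans (ler_normB _ _) _.
by rewrite lerD2l.
Qed.

(** Over chart i the explicit formula is smooth; a point outside chart i has a neighbourhood missing
    the closed support, where the field is 0. *)
Lemma smooth_cutoff_field j : smooth_on (ccod j) (cutoff_field j).
Proof.
apply: smooth_on_locally => x Ox.
have [px|npx] := pselect (cdom i (cinv j x)).
  exists (fun y => bump_function x0 r (transition j i y) *:
    'D_P (transition i j) (transition j i y)).
    have := cinv_nbhs Ox (cdom_open i) px.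
    by apply: filterS => y [Oy iy]; rewrite /cutoff_field asboolT.
  apply: (@smooth_onS _ _ _ _ (cmap j @` (cdom j `&` cdom i))).
    by move=> _ ->; apply/overlapE.
  have oA : open (cmap j @` (cdom j `&` cdom i)) by exact: open_overlap.
  apply: smooth_onZ => //.
    apply: (smooth_on_comp (has_coords_mx _ _) oA (B := setT) (g := bump_function x0 r)) => //.
      exact: smooth_on_bump.
    exact: transition_smooth.
  apply: (smooth_on_comp (has_coords_mx _ _) oA (B := cmap i @` (cdom i `&` cdom j))
    (g := 'D_P (transition i j))).
  - by move=> y /overlapE [Oy iy]; exact: transition_overlap.
  - by apply: smooth_on_derive; exact: transition_smooth.
  - exact: transition_smooth.
exists (fun=> 0); last exact: smooth_on_cst.
have oK : open (~` (cinv i @` closed_ball x0 r)) by apply: closed_openC; exact: closed_support.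
have nK : (~` (cinv i @` closed_ball x0 r)) (cinv j x).
  move=> [y Ky yx]; apply: npx; rewrite -yx; exact: (cinvK (ball_ccod Ky)).1.
have := cinv_nbhs Ox oK nK.
apply: filterS => y [Oy nKy]; rewrite /cutoff_field; case: asboolP => // iy.
rewrite bump_eq0 ?scale0r// => Ky; apply: nKy; exists (cmap i (cinv j y)) => //.
by rewrite cmapK.
Qed.

Lemma cutoff_field_transition j k x : ccod j x -> cdom k (cinv j x) ->
  cutoff_field k (transition j k x) = 'D_(cutoff_field j x) (transition j k) x.
Proof.
move=> Ox kx; rewrite /cutoff_field.
have -> : cinv k (transition j k x) = cinv j x by rewrite /transition /= cmapK.
case: asboolP => ix; last by rewrite derive0.
set y := cmap i (cinv j x).
have Oy : ccod i y by exists (cinv j x).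
have yp : cinv i y = cinv j x by rewrite /y cmapK.
have yx : transition i j y = x by rewrite /transition /= yp; exact: (cinvK Ox).2.
rewrite deriveZdir; last exact: diff_transition.
have jy : cdom j (cinv i y) by rewrite yp; exact: (cinvK Ox).1.
have ky : cdom k (cinv i y) by rewrite yp.
by rewrite (derive_transition_comp P Oy jy ky) yx.
Qed.

(** Projecting off u makes the lift tangent to the unit bundle, and the projection commutes with
    coordinate changes because these are isometries on fibres. *)
Definition vertical_lift (j : chart M) (w : E) : E :=
  vlift (cutoff_field j w.1 -
    ((sqnorm (gram g j) w)^-1 * gform (gram g j) w.1 (cutoff_field j w.1) w.2) *: w.2).

(** The bundle transition is linear on fibres, so along a vertical direction its difference quotient
    does not depend on h. *)
Lemma derive_bundle_transition j k z Q : ccod j z.1 -> cdom k (cinv j z.1) ->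
  'D_(vlift Q) (bundle_transition j k) z = vlift ('D_Q (transition j k) z.1).
Proof.
move=> Oz kz; have d := diff_transition Oz kz.
apply: lim_near_cst => //.
near=> h.
have h0 : h != 0 by near: h; exact: nbhs_dnbhs_neq.
rewrite /bundle_transition /= scaler0 add0r deriveDdir// deriveZdir//.
congr pair => /=; first by rewrite subrr scaler0.
by rewrite addrK scalerA mulVf// scale1r.
Unshelve. all: by end_near. Qed.

Lemma vector_field_vertical_lift : vector_field g vertical_lift.
Proof.
split=> [j|j k z [Oz zz] kz].
  have lm := chart_metric j.
  apply: (vertical_field lm (Q := fun w => cutoff_field j w.1)).
  apply: (smooth_on_comp (has_coords_mx _ _) (open_slit lm) (B := ccod j)
    (g := cutoff_field j) _ _ (smooth_base lm)).
    by move=> w [].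
  exact: smooth_cutoff_field.
rewrite derive_bundle_transition// /vertical_lift; congr vlift.
have d := diff_transition Oz kz.
have [jz zx] := cinvK Oz.
have comp u v : gform (gram g j) z.1 u v = gform (gram g k) (transition j k z.1)
    ('D_u (transition j k) z.1) ('D_v (transition j k) z.1).
  by have := gram_compat g u v jz kz; rewrite zx.
rewrite /sqnorm [(bundle_transition j k z).1]/= [(bundle_transition j k z).2]/=.
rewrite cutoff_field_transition// -!comp.
by rewrite deriveDdir// -[in RHS]scaleNr deriveZdir// scaleNr.
Qed.

End Field.

Lemma exists_vertical_field i z P : unit_tangent g i z ->
  gform (gram g i) z.1 P z.2 = 0 ->
  exists2 U, vector_field g U & U i z = vlift P.
Proof.
move=> [Oz zz] Pz.
have /nbhs_ballP[e /= e0 He] := open_nbhs_nbhs (conj (@cmap_open R n M i) Oz).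
have r0 : 0 < e / 2 by rewrite divr_gt0.
have Hr : closed_ball z.1 (e / 2) `<=` ccod i.
  apply: subset_trans He; apply: closed_ball_subset => //.
  by rewrite ltr_pdivrMr// ltr_pMr// ltr1n.
(* Dividing P by the value of the bump at its centre makes the field take exactly the value P
   there. *)
pose be := bump_function z.1 (e / 2) z.1.
have be0 : be != 0 by exact: bump_center.
exists (vertical_lift i z.1 (be^-1 *: P) (e / 2)).
  exact: vector_field_vertical_lift.
have [iz zx] := cinvK Oz.
have E : cutoff_field i z.1 (be^-1 *: P) (e / 2) i z.1 = P.
  rewrite /cutoff_field asboolT// zx derive_transition_self// scalerA mulfV// scale1r.
  by [].
by rewrite /vertical_lift E Pz mulr0 scale0r subr0.
Qed.

End GlobalField.

Theorem theorem3p7 (R : realType) (n : nat) (M : manifold R n)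
    (g : riemannian_metric M) (a b : R -> R) (eps : R)
    (a_smooth : smooth_half_line a) (b_smooth : smooth_half_line b)
    (a_gt0 : forall t : R, 0 <= t -> 0 < a t)
    (b_ge0 : forall t : R, 0 <= t -> 0 <= b t)
    (eps_pm1 : eps = 1 \/ eps = -1)
    (nabla : chart M -> (bundle R n -> bundle R n) ->
             (bundle R n -> bundle R n) -> bundle R n -> bundle R n)
    (nabla_LC : levi_civita_connection g a b nabla) :
  (K_contact g a b eps nabla <-> constant_sectional_curvature g (a 2^-1)^-1) /\
  (K_contact g a b eps nabla -> Sasakian g a b eps nabla).
Proof.
have eps2 : eps * eps = 1 by case: eps_pm1 => ->; rewrite ?mulrNN mulr1.
have KC : K_contact g a b eps nabla -> constant_sectional_curvature g (a 2^-1)^-1.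
  move=> K i x X Y Ox free; have lm := chart_metric g i.
  apply: (curv_constant_sectional lm Ox) free => {}X y yy P Py.
  have uz : unit_tangent g i (x, y) by [].
  (* The hypothesis [K] applies to global fields only, so the vertical vector P at (x, y) is
     extended over all charts. *)
  have [U fU Uz] := exists_vertical_field uz Py.
  exact: (K_contact_curv lm a_smooth b_smooth a_gt0 b_ge0 eps2 (nabla_LC i) uz
    (fU.1 i) Py Uz (K U fU i _ uz)).
have curv_const i z : constant_sectional_curvature g (a 2^-1)^-1 -> unit_tangent g i z ->
    forall X Y Z, curv (gram g i) z.1 X Y Z = (a 2^-1)^-1 *:
      (gform (gram g i) z.1 Y Z *: X - gform (gram g i) z.1 X Z *: Y).
  move=> C [Oz _]; apply: (sectional_constant_curv (chart_metric g i) Oz) => X Y.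
  exact: C.
split; first split=> // C U fU i z uz.
  apply: (K_contact_local (chart_metric g i) a_smooth b_smooth a_gt0 b_ge0 eps2
    (nabla_LC i) uz (fU.1 i)).
  exact: curv_const.
move=> /KC C U V fU fV i z uz.
apply: (Sasakian_local (chart_metric g i) a_smooth b_smooth a_gt0 b_ge0 eps2
  (nabla_LC i) uz (fU.1 i) (fV.1 i)).
exact: curv_const.
Qed.
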